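(* Let $(E,Q\equiv(\{l_k\}_{k\ge1},\rho))$ be a Lie $\infty$-algebroid over $M$ and $V$ a graded vector bundle over $M$. There is a one-to-one correspondence between Lie $\infty$-algebroid connections $\nabla=(\nabla^{(k)})_{k\ge0}$ of $(E,Q)$ on $V$ and degree $+1$ operators $$\mathcal D:\Gamma(S(E^* )\otimes V^* )\to\Gamma(S(E^* )\otimes V^* )$$ such that, for all $\xi\in\Gamma(S(E^* ))$ and $\omega\in\Gamma(S(E^* )\otimes V^* )$, $$\mathcal D(\xi\cdot\omega)=Q(\xi)\cdot\omega+(-1)^{|\xi|}\xi\cdot\mathcal D\omega .$$ The correspondence is given by $$\langle\mathcal D\alpha,\,e_1\odot\cdots\odot e_k\otimes v\rangle=(-1)^{|\alpha|}\langle\alpha,\nabla^{(k)}_{e_1\odot\cdots\odot e_k}v\rangle+(-1)^{|\alpha|+1}\rho(e_1\odot\cdots\odot e_k)[\langle\alpha,v\rangle]$$ for all $\alpha\in\Gamma(V^* )$, $v\in\Gamma(V)$, $e_1\odot\cdots\odot e_k\in\Gamma(S^k(E))$, $k\ge0$, with the understanding that $\rho(e_1\odot\cdots\odot e_k)$ is zero unless $k=1$ and $e_1\in\Gamma(E_{-1})$.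
   Context: $M$ is a smooth manifold, a complex manifold, or an affine variety, $\mathcal O$ its sheaf of functions, $\Gamma$ denotes (sheaves of) sections. Graded vector bundles $V=\oplus_iV_i$ have finite rank; $(V^* )_i=(V_{-i})^*$. Lie $\infty$-algebroid (negatively graded): a graded vector bundle $E=\oplus_{i\ge1}E_{-i}$ over $M$, a vector bundle morphism $\rho:E_{-1}\to TM$ (anchor), and degree $+1$ graded symmetric brackets $l_k=\{-,\dots,-\}_k$, $k\ge 1$, on $\Gamma(E)$ satisfying, for all $n\ge1$ and homogeneous $x_i$, $\sum_{i+j=n+1}\sum_{\sigma\in Sh(i,j-1)}\epsilon(\sigma)l_j(l_i(x_{\sigma(1)},\dots,x_{\sigma(i)}),x_{\sigma(i+1)},\dots,x_{\sigma(n)})=0$ ($\epsilon(\sigma)$ the Koszul sign for the graded symmetric product, $Sh$ the unshuffles). All $l_k$ are $\mathcal O$-linear in each argument, except $l_2$ when at least one entry has degree $-1$, in which case $\{x,fy\}_2=f\{x,y\}_2+\rho(x)[f]\,y$ for $x\in\Gamma(E_{-1})$, $y\in\Gamma(E)$. Let $\mathcal E=\Gamma(S(E^* ))$ ($S$ = graded symmetric algebra, product $\odot$, $E_{-i}^*$ in degree $+i$). The corresponding $Q$ is the degree $+1$ derivation of $\mathcal E$, squaring to $0$, with components $Q^{(k)}$ raising the number of $E^*$-factors (arity) by $k$: for $f\in\mathcal O$, $\alpha\in\Gamma(E^* )$, $\langle Q(f),e\rangle=-\rho(e)[f]$; $\langle Q^{(0)}(\alpha),e\rangle=(-1)^{|\alpha|}\langle\alpha,l_1(e)\rangle$;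 $\langle Q^{(1)}(\alpha),e_1\odot e_2\rangle=(-1)^{|\alpha|}\langle\alpha,\{e_1,e_2\}_2\rangle-(-1)^{|e_2|}\rho(e_1)[\langle\alpha,e_2\rangle]-\rho(e_2)[\langle\alpha,e_1\rangle]$; $Q^{(n-1)}(\alpha)(e_1\odot\cdots\odot e_n)=(-1)^{|\alpha|}\langle\alpha,l_n(e_1,\dots,e_n)\rangle$ for $n\ge3$ ($\rho$ is extended by $0$ to $E_{-i}$, $i\ge2$). Pairings follow the Koszul rule $(f\otimes g)(x\otimes y)=(-1)^{|x||g|}f(x)g(y)$. Lie $\infty$-algebroid connection of $(E,Q)$ on $V$: a family of degree $+1$ maps $\nabla^{(k)}:\Gamma(S^k(E))\times\Gamma(V)\to\Gamma(V)$, $k\ge0$ (Taylor coefficients), such that for $f\in\mathcal O$: $\nabla^{(k)}_{fe_1\odot\cdots\odot e_k}v=f\nabla^{(k)}_{e_1\odot\cdots\odot e_k}v$; for $k\ne1$, $\nabla^{(k)}_{e_1\odot\cdots\odot e_k}(fv)=f\nabla^{(k)}_{e_1\odot\cdots\odot e_k}v$; and $\nabla^{(1)}_{e_1}(fv)=f\nabla^{(1)}_{e_1}v+\rho(e_1)[f]v$. In particular $\nabla^{(0)}:V\to V$ is a degree $+1$ bundle morphism. The left $\Gamma(S(E^* ))$-module structure is $F\cdot(G\otimes\beta)=(F\odot G)\otimes\beta$, and $\mathcal O=\Gamma(S^0(E^* ))$. *)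

(* Defs.v *)
From HB Require Import structures.
From mathcomp Require Import all_boot all_order all_algebra.
From mathcomp Require Import all_classical all_reals all_analysis.
From mathcomp Require Import complex ring.
From mathcomp Require mpoly.

Set Implicit Arguments.
Unset Strict Implicit.
Unset Printing Implicit Defensive.

Import Order.TTheory GRing.Theory Num.Theory numFieldNormedType.Exports.

Local Open Scope classical_set_scope.
Local Open Scope ring_scope.

(* A topological space with a sheaf of K-valued functions.  Sections over an
   open set U (here and for all sheaves below) are represented by functions
   defined on the whole space of which only the values on U matter: membership
   in [fs_O U] depends only on the restriction to U ([fs_ext]), and equality of
   sections over U is pointwise equality on U. *)
Record fspace (K : fieldType) := FSpace {
  fs_space :> topologicalType;
  fs_O : set fs_space -> set (fs_space -> K);
  fs_ext : forall U f g, open U -> (forall x, U x -> f x = g x) ->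
    fs_O U f -> fs_O U g;
  fs_restr : forall U U' f, open U -> open U' -> U' `<=` U ->
    fs_O U f -> fs_O U' f;
  fs_glue : forall U f, open U ->
    (forall x, U x -> exists U', [/\ open U', U' x, U' `<=` U & fs_O U' f]) ->
    fs_O U f;
  fs_cst : forall U c, open U -> fs_O U (fun=> c);
  fs_add : forall U f g, open U -> fs_O U f -> fs_O U g ->
    fs_O U (fun x => f x + g x);
  fs_mul : forall U f g, open U -> fs_O U f -> fs_O U g ->
    fs_O U (fun x => f x * g x)
}.

Record chart (T : Type) (V : Type) := Chart {
  ch_dom : set T; ch_cod : set V; ch_to : T -> V; ch_from : V -> T }.

Definition is_chart (T V : topologicalType) (c : chart T V) : Prop :=
  [/\ open (ch_dom c) /\ open (ch_cod c),
      (forall x, ch_dom c x ->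
         ch_cod c (ch_to c x) /\ ch_from c (ch_to c x) = x),
      (forall y, ch_cod c y ->
         ch_dom c (ch_from c y) /\ ch_to c (ch_from c y) = y),
      (forall x, ch_dom c x -> {for x, continuous (ch_to c)}) &
      (forall y, ch_cod c y -> {for y, continuous (ch_from c)})].

(* [reg n W f] : "f is a regular function on the open set W of F^n". *)
Definition manifold (F : numFieldType)
    (reg : forall n, set 'rV[F]_n -> ('rV[F]_n -> F) -> Prop)
    (X : fspace F) : Prop :=
  [/\ hausdorff_space X, @second_countable X &
  exists (n : nat) (A : set (chart X 'rV[F]_n)),
    [/\ (forall c, A c -> is_chart c),
        (forall x : X, exists2 c, A c & ch_dom c x),
        (forall c c', A c -> A c' -> forall i : 'I_n,
           reg n (ch_cod c `&` (ch_from c @^-1` ch_dom c'))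
                 (fun y => ch_to c' (ch_from c y) 0 i)) &
        (forall U f, open U ->
           (fs_O U f <-> forall c, A c ->
              reg n (ch_cod c `&` (ch_from c @^-1` U)) (f \o ch_from c)))]].

Fixpoint class_C (R : realType) (n k : nat) (W : set 'rV[R]_n)
    (f : 'rV[R]_n -> R) : Prop :=
  if k is k'.+1 then
    (forall x, W x -> differentiable f x) /\ (forall v, class_C k' W ('D_v f))
  else forall x, W x -> {for x, continuous f}.

Definition smooth_on (R : realType) (n : nat) (W : set 'rV[R]_n)
    (f : 'rV[R]_n -> R) : Prop := forall k, class_C k W f.

Definition smooth_manifold (R : realType) (X : fspace R) : Prop :=
  manifold (@smooth_on R) X.

(* For F = R[i] this is Frechet differentiability over the complex numbers. *)
Definition holomorphic_on (F : numFieldType) (n : nat) (W : set 'rV[F]_n)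
    (f : 'rV[F]_n -> F) : Prop :=
  forall x, W x -> differentiable (f : 'rV[F]_n -> F^o) x.

Definition complex_manifold (R : realType) (X : fspace R[i]) : Prop :=
  @manifold R[i] (@holomorphic_on R[i]) X.

(* A Zariski closed subset of K^n, with the Zariski topology and the sheaf of
   functions that are locally quotients of polynomials. *)
Definition affine_variety (K : fieldType) (X : fspace K) : Prop :=
  exists (n : nat) (phi : X -> 'I_n -> K) (I : set (mpoly.mpoly n K)),
    [/\ injective phi,
        (forall a : 'I_n -> K,
           (exists x, phi x = a) <-> (forall p, I p -> mpoly.meval a p = 0)),
        (forall U : set X, open U <->
           exists J : set (mpoly.mpoly n K), forall x,
             U x <-> exists2 p, J p & mpoly.meval (phi x) p != 0) &
        (forall U f, open U ->
           (fs_O U f <-> forall x, U x ->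
              exists (U' : set X) (p q : mpoly.mpoly n K),
                [/\ open U', U' x, U' `<=` U &
                    forall y, U' y -> mpoly.meval (phi y) q != 0 /\
                      f y = mpoly.meval (phi y) p / mpoly.meval (phi y) q]))].

Inductive base_space : forall K : fieldType, fspace K -> Prop :=
| BaseSmooth (R : realType) (X : fspace R) :
    smooth_manifold X -> base_space X
| BaseComplex (R : realType) (X : fspace R[i]) :
    complex_manifold X -> base_space X
| BaseAffine (K : fieldType) (X : fspace K) :
    [pchar K] =i pred0 -> affine_variety X -> base_space X.

Section Sections.
Variables (K : fieldType) (X : fspace K) (fib : X -> vectType K).
Implicit Types (U : set X) (s : forall x, fib x).

Record lframe := LFrame {
  lf_dom : set X; lf_rank : nat; lf_sec : 'I_lf_rank -> forall x, fib x }.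

Definition is_frame (A : lframe) : Prop :=
  open (lf_dom A) /\
  forall x, lf_dom A x ->
    basis_of fullv [seq lf_sec i x | i <- enum 'I_(lf_rank A)].

Definition frame_section (F : set lframe) U s : Prop :=
  forall A, F A -> exists f : 'I_(lf_rank A) -> X -> K,
    (forall i, fs_O (U `&` lf_dom A) (f i)) /\
    (forall x, U x -> lf_dom A x -> s x = \sum_i f i x *: lf_sec i x).
End Sections.

(* A vector bundle over X given by its fibres and an atlas of local frames;
   [vb_compat] says that the transition matrices are regular. *)
Record vbundle (K : fieldType) (X : fspace K) := VBundle {
  vb_fib :> X -> vectType K;
  vb_frames : set (lframe vb_fib);
  vb_frame : forall A, vb_frames A -> is_frame A;
  vb_cover : forall x, exists2 A, vb_frames A & lf_dom A x;
  vb_compat : forall A (i : 'I_(lf_rank A)), vb_frames A ->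
    frame_section vb_frames (lf_dom A) (lf_sec i)
}.

(* Gamma(U, B) *)
Definition bsec (K : fieldType) (X : fspace K) (B : vbundle X) :
    set X -> set (forall x, B x) := @frame_section K X B (@vb_frames K X B).

Record gbundle (K : fieldType) (X : fspace K) := GBundle {
  gb_comp :> int -> vbundle X;
  gb_finite : exists N : nat, forall (n : int) x, (N < `|n|)%N ->
    \dim {:gb_comp n x} = 0%N
}.

Section Graded.
Variables (K : fieldType) (X : fspace K).
Implicit Types (E V : gbundle X) (U : set X).

Definition hvec E (x : X) := {n : int & E n x}.
Definition hsec E := {n : int & forall x, E n x}.
(* Sections of the total bundle, as families of homogeneous components; the
   family is finitely supported since E has finite rank. *)
Definition tsec E := forall (n : int) (x : X), E n x.

Definition Hvec E x n (u : E n x) : hvec E x := existT (fun n => E n x) n u.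
Definition Hsec E n (s : forall x, E n x) : hsec E :=
  existT (fun n => forall x, E n x) n s.
Definition at_pt E (x : X) (e : hsec E) : hvec E x := Hvec (projT2 e x).
(* the total section whose only nonzero component is e *)
Definition tot E (e : hsec E) : tsec E :=
  fun n x => untag 0 (fun u : E n x => u) (at_pt x e).

Definition is_hsec E U (e : hsec E) : Prop := bsec U (projT2 e).

Definition degs E (es : seq (hsec E)) : seq int := [seq tag e | e <- es].
Definition vdegs E x (es : seq (hvec E x)) : seq int := [seq tag e | e <- es].
Definition sdeg (ds : seq int) : int := \sum_(d <- ds) d.

(* (-1)^(a b) *)
Definition ksign (a b : int) : K := (-1) ^ (a * b).

(* A mask m on a word es encodes an unshuffle: the letters selected by m are
   moved, in order, to the front.  [ueps m ds] is the Koszul sign epsilon of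
   that unshuffle for letters of degrees ds. *)
Definition cmask (T : Type) (m : bitseq) (s : seq T) : seq T :=
  mask (map negb m) s.

Fixpoint ueps (m : bitseq) (ds : seq int) : K :=
  match m, ds with
  | b :: m', d :: ds' =>
      (if b then 1 else ksign d (sdeg (mask m' ds'))) * ueps m' ds'
  | _, _ => 1
  end.

(* An element of (V^* )_x is a function on homogeneous vectors, linear on each
   V_(n,x); it is in degree a iff it vanishes on V_(n,x) for n <> - a. *)
Definition dsection V := forall x, hvec V x -> K.

Definition is_dual V U (a : dsection V) : Prop :=
  [/\ (forall x n (c : K) (u v : V n x), U x ->
         a x (Hvec (c *: u + v)) = c * a x (Hvec u) + a x (Hvec v)) &
      (forall U' n (s : forall x, V n x), open U' -> U' `<=` U ->
         bsec U' s -> fs_O U' (fun x => a x (Hvec (s x))))].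

Definition dual_deg V U (a : dsection V) (d : int) : Prop :=
  forall x (v : hvec V x), U x -> a x v != 0 -> tag v = - d.

(* S(E_x^* ) is realised in the algebra of K-valued functions on words of
   homogeneous vectors, xi being sent to
     (e_1, ..., e_k) |-> < xi, e_1 (.) ... (.) e_k > ,
   with the Koszul shuffle product [fmul]; S(E_x^* ) is the subalgebra generated
   by E_x^* (in characteristic 0 the canonical map from the graded symmetric
   algebra is injective).  Likewise S(E_x^* ) (x) V_x^*. *)
Definition sform E := forall x, seq (hvec E x) -> K.
Definition vform E V := forall x, seq (hvec E x) -> hvec V x -> K.

Definition of_fun E (f : X -> K) : sform E :=
  fun x es => if es is [::] then f x else 0.
#[global] Arguments of_fun E f x es : clear implicits.
Definition of_dual E (a : dsection E) : sform E :=
  fun x es => if es is [:: e] then a x e else 0.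

#[global] Arguments of_dual {E} a x es.
(* F (.) G ; the factor [ksign] is the sign of (F (x) G)(es' (x) es''). *)
Definition fmul E (F G : sform E) : sform E := fun x es =>
  \sum_(m : (size es).-tuple bool)
    ueps m (vdegs es) *
    ksign (sdeg (vdegs (mask m es))) (sdeg (vdegs (cmask m es))) *
    F x (mask m es) * G x (cmask m es).

#[global] Arguments fmul {E} F G x es.
(* The action F . w *)
Definition fscale E V (F : sform E) (w : vform E V) : vform E V := fun x es v =>
  \sum_(m : (size es).-tuple bool)
    ueps m (vdegs es) *
    ksign (sdeg (vdegs (mask m es))) (sdeg (vdegs (cmask m es)) + tag v) *
    F x (mask m es) * w x (cmask m es) v.

#[global] Arguments fscale {E V} F w x es v.
(* F (x) b *)
Definition ftens E V (F : sform E) (b : dsection V) : vform E V := fun x es v =>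
  ksign (sdeg (vdegs es)) (tag v) * F x es * b x v.

#[global] Arguments ftens {E V} F b x es v.

Lemma sdeg_mask m ds : size m = size ds ->
  sdeg (mask m ds) + sdeg (cmask m ds) = sdeg ds.
Proof.
rewrite /sdeg /cmask; elim: m ds => [|b m IH] [|d ds] //=.
  by rewrite !big_nil addr0.
move=> [/IH e]; rewrite [RHS]big_cons -e.
by case: b; rewrite /= big_cons ?addrA // (addrC d).
Qed.

Lemma fscale_ftens E V (F G : sform E) (b : dsection V) x es v :
  fscale F (ftens G b) x es v = ftens (fmul F G) b x es v.
Proof.
rewrite /fscale /ftens /fmul mulr_sumr mulr_suml; apply: eq_bigr => m _.
have -> : sdeg (vdegs es) =
    sdeg (vdegs (mask m es)) + sdeg (vdegs (cmask m es)).
  by rewrite -[LHS](@sdeg_mask m) ?size_map ?size_tuple // /vdegs /cmask !map_mask.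
have ks_l p q r : ksign (p + q) r = ksign p r * ksign q r.
  by rewrite /ksign mulrDl expfzDr ?oppr_eq0 ?oner_eq0.
have ks_r p q r : ksign p (q + r) = ksign p q * ksign p r.
  by rewrite /ksign mulrDr expfzDr ?oppr_eq0 ?oner_eq0.
rewrite ks_l ks_r; ring.
Qed.

(* a_1 (.) ... (.) a_k *)
Definition sym_prod E (al : seq (dsection E)) : sform E :=
  foldr (fun a F => fmul (of_dual a) F) (of_fun E (fun=> 1)) al.

#[global] Arguments sym_prod {E} al x es.
(* Gamma(U, S(E^* )) : locally finite sums of products of a function and
   sections of E^*. *)
Definition is_form E U (xi : sform E) : Prop :=
  forall x, U x -> exists U', [/\ open U', U' x, U' `<=` U &
    exists (N : nat) (f : 'I_N -> X -> K) (al : 'I_N -> seq (dsection E)),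
      [/\ (forall j, fs_O U' (f j)),
          (forall j i, (i < size (al j))%N ->
             is_dual U' (nth (fun _ _ => 0) (al j) i)) &
          (forall y es, U' y ->
             xi y es = \sum_j f j y * sym_prod (al j) y es)]].

(* Gamma(U, S(E^* ) (x) V^* ) *)
Definition is_vform E V U (w : vform E V) : Prop :=
  forall x, U x -> exists U', [/\ open U', U' x, U' `<=` U &
    exists (N : nat) (xi : 'I_N -> sform E) (b : 'I_N -> dsection V),
      [/\ (forall j, is_form U' (xi j)),
          (forall j, is_dual U' (b j)) &
          (forall y es v, U' y ->
             w y es v = \sum_j ftens (xi j) (b j) y es v)]].

Definition form_deg E U (xi : sform E) (d : int) : Prop :=
  forall x es, U x -> xi x es != 0 -> sdeg (vdegs es) = - d.
Definition vform_deg E V U (w : vform E V) (d : int) : Prop :=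
  forall x es v, U x -> w x es v != 0 -> sdeg (vdegs es) + tag v = - d.

(* < a, t > for a homogeneous of degree d *)
Definition dual_tot V (a : dsection V) (d : int) (t : tsec V) : X -> K :=
  fun x => a x (Hvec (t (- d) x)).
(* < a, e > *)
Definition dual_app V (a : dsection V) (e : hsec V) : X -> K :=
  fun x => a x (at_pt x e).

(* T_x X : derivations at x of (germs of) regular functions.  The values on
   functions that are not regular near x are irrelevant.  Sections of the tangent
   bundle are thus derivations of the sheaf of functions. *)
Definition tangent (x : X) (D : (X -> K) -> K) : Prop :=
  forall U, open U -> U x ->
  [/\ (forall f g, fs_O U f -> fs_O U g ->
         D (fun y => f y * g y) = D f * g x + f x * D g),
      (forall (c : K) f g, fs_O U f -> fs_O U g ->
         D (fun y => c * f y + g y) = c * D f + D g) &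
      (forall f g, fs_O U f -> fs_O U g ->
         (forall y, U y -> f y = g y) -> D f = D g)].

Record is_anchor E (rho : forall x, E (-1) x -> (X -> K) -> K) : Prop := {
  anchor_tangent : forall x u, tangent x (rho x u);
  anchor_linear : forall x (c : K) u v U f, open U -> U x -> fs_O U f ->
    rho x (c *: u + v) f = c * rho x u f + rho x v f;
  anchor_regular : forall U (s : forall x, E (-1) x) f, open U ->
    bsec U s -> fs_O U f -> fs_O U (fun x => rho x (s x) f)
}.

(* rho(e_1 (.) ... (.) e_k)[f] at x: zero unless k = 1 and |e_1| = -1. *)
Definition rho_ext E (rho : forall x, E (-1) x -> (X -> K) -> K) (x : X)
    (es : seq (hvec E x)) (f : X -> K) : K :=
  if es is [:: e] then untag 0 (fun u : E (-1) x => rho x u f) e else 0.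

Definition pts E (x : X) (es : seq (hsec E)) : seq (hvec E x) :=
  [seq at_pt x e | e <- es].

Definition all_hsec E U (es : seq (hsec E)) : Prop :=
  forall p e q, es = p ++ e :: q -> is_hsec U e.

(* Brackets: [l U [:: e_1; ...; e_k]] is l_k(e_1, ..., e_k), for sections e_i
   over U; only k >= 1 is used. *)
Record is_lie_infty E (rho : forall x, E (-1) x -> (X -> K) -> K)
    (l : set X -> seq (hsec E) -> tsec E) : Prop := {
  li_negative : forall (n : int) x, 0 <= n -> \dim {:E n x} = 0%N;
  li_anchor : is_anchor rho;
  li_section : forall U es n, open U -> es <> [::] -> all_hsec U es ->
    bsec U (l U es n);
  li_local : forall U U' es es', open U -> open U' -> U' `<=` U ->
    es <> [::] -> all_hsec U es -> all_hsec U' es' ->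
    (forall x, U' x -> pts x es = pts x es') ->
    forall n x, U' x -> l U es n x = l U' es' n x;
  li_degree : forall U es n x, open U -> es <> [::] -> all_hsec U es ->
    U x -> n != sdeg (degs es) + 1 -> l U es n x = 0;
  li_sym : forall U p a b q n x, open U ->
    all_hsec U (p ++ a :: b :: q) -> U x ->
    l U (p ++ a :: b :: q) n x =
      ksign (tag a) (tag b) *: l U (p ++ b :: a :: q) n x;
  li_add : forall U p d (s t : forall x, E d x) q n x, open U ->
    all_hsec U (p ++ Hsec s :: q) -> all_hsec U (p ++ Hsec t :: q) -> U x ->
    l U (p ++ Hsec (fun y => s y + t y) :: q) n x =
      l U (p ++ Hsec s :: q) n x + l U (p ++ Hsec t :: q) n x;
  li_linear : forall U p d (s : forall x, E d x) q f n x, open U ->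
    (size p + size q)%N <> 1%N ->
    fs_O U f -> all_hsec U (p ++ Hsec s :: q) -> U x ->
    l U (p ++ Hsec (fun y => f y *: s y) :: q) n x =
      f x *: l U (p ++ Hsec s :: q) n x;
  (* rho is extended by 0 outside E_{-1}, so that this also says that
     {e, - }_2 is O-linear when |e| <> -1. *)
  li_leibniz : forall U e d (s : forall x, E d x) f n x, open U ->
    fs_O U f -> all_hsec U [:: e; Hsec s] -> U x ->
    l U [:: e; Hsec (fun y => f y *: s y)] n x =
      f x *: l U [:: e; Hsec s] n x +
      rho_ext rho [:: at_pt x e] f *: tot (Hsec s) n x;
  li_jacobi : forall U es n x, open U -> es <> [::] -> all_hsec U es -> U x ->
    \sum_(m : (size es).-tuple bool | has id m)
      ueps m (degs es) *:
      l U (Hsec (l U (mask m es) (sdeg (degs (mask m es)) + 1))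
             :: cmask m es) n x = 0
}.

Record lie_infty_algebroid E := LieInfty {
  li_rho : forall x, E (-1) x -> (X -> K) -> K;
  li_br : set X -> seq (hsec E) -> tsec E;
  li_laws : is_lie_infty li_rho li_br
}.

(* [Q] is the homological vector field dual to (l, rho). *)
Record is_homological E (L : lie_infty_algebroid E)
    (Q : set X -> sform E -> sform E) : Prop := {
  hQ_section : forall U xi, open U -> is_form U xi -> is_form U (Q U xi);
  hQ_local : forall U U' xi xi', open U -> open U' -> U' `<=` U ->
    is_form U xi -> is_form U' xi' ->
    (forall x es, U' x -> xi x es = xi' x es) ->
    forall x es, U' x -> Q U xi x es = Q U' xi' x es;
  hQ_linear : forall U (c : K) xi eta, open U -> is_form U xi ->
    is_form U eta -> forall x es, U x ->
    Q U (fun y fs => c * xi y fs + eta y fs) x es =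
      c * Q U xi x es + Q U eta x es;
  hQ_degree : forall U xi d, open U -> is_form U xi -> form_deg U xi d ->
    form_deg U (Q U xi) (d + 1);
  hQ_derivation : forall U xi eta d, open U -> is_form U xi ->
    is_form U eta -> form_deg U xi d -> forall x es, U x ->
    Q U (fmul xi eta) x es =
      fmul (Q U xi) eta x es + (-1) ^ d * fmul xi (Q U eta) x es;
  hQ_square : forall U xi, open U -> is_form U xi ->
    forall x es, U x -> Q U (Q U xi) x es = 0;
  hQ_fun : forall U f e x, open U -> fs_O U f -> is_hsec U e -> U x ->
    Q U (of_fun E f) x [:: at_pt x e] =
      - rho_ext (li_rho L) [:: at_pt x e] f;
  hQ_dual2 : forall U a d e1 e2 x, open U -> is_dual U a -> dual_deg U a d ->
    is_hsec U e1 -> is_hsec U e2 -> U x ->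
    Q U (of_dual a) x [:: at_pt x e1; at_pt x e2] =
      (-1) ^ d * dual_tot a d (li_br L U [:: e1; e2]) x
      - (-1) ^ (tag e2) * rho_ext (li_rho L) [:: at_pt x e1] (dual_app a e2)
      - rho_ext (li_rho L) [:: at_pt x e2] (dual_app a e1);
  hQ_dual : forall U a d es x, open U -> is_dual U a -> dual_deg U a d ->
    all_hsec U es -> (size es = 1%N \/ (3 <= size es)%N) -> U x ->
    Q U (of_dual a) x (pts x es) = (-1) ^ d * dual_tot a d (li_br L U es) x
}.

(* [nabla U [:: e_1; ...; e_k] v] is nabla^(k)_{e_1 (.) ... (.) e_k} v; an
   O-linear map out of Gamma(S^k(E)) is given as a graded symmetric O-multilinear
   map on Gamma(E). *)
Definition taylor E V := set X -> seq (hsec E) -> hsec V -> tsec V.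

Record is_connection E (L : lie_infty_algebroid E) V (nabla : taylor E V) :
    Prop := {
  cn_section : forall U es v n, open U -> all_hsec U es -> is_hsec U v ->
    bsec U (nabla U es v n);
  cn_local : forall U U' es es' v v', open U -> open U' -> U' `<=` U ->
    all_hsec U es -> all_hsec U' es' -> is_hsec U v -> is_hsec U' v' ->
    (forall x, U' x -> pts x es = pts x es' /\ at_pt x v = at_pt x v') ->
    forall n x, U' x -> nabla U es v n x = nabla U' es' v' n x;
  cn_degree : forall U es v n x, open U -> all_hsec U es -> is_hsec U v ->
    U x -> n != sdeg (degs es) + tag v + 1 -> nabla U es v n x = 0;
  cn_sym : forall U p a b q v n x, open U ->
    all_hsec U (p ++ a :: b :: q) -> is_hsec U v -> U x ->
    nabla U (p ++ a :: b :: q) v n x =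
      ksign (tag a) (tag b) *: nabla U (p ++ b :: a :: q) v n x;
  cn_add : forall U p d (s t : forall x, E d x) q v n x, open U ->
    all_hsec U (p ++ Hsec s :: q) -> all_hsec U (p ++ Hsec t :: q) ->
    is_hsec U v -> U x ->
    nabla U (p ++ Hsec (fun y => s y + t y) :: q) v n x =
      nabla U (p ++ Hsec s :: q) v n x + nabla U (p ++ Hsec t :: q) v n x;
  cn_linear : forall U p d (s : forall x, E d x) q v f n x, open U ->
    fs_O U f -> all_hsec U (p ++ Hsec s :: q) -> is_hsec U v -> U x ->
    nabla U (p ++ Hsec (fun y => f y *: s y) :: q) v n x =
      f x *: nabla U (p ++ Hsec s :: q) v n x;
  cn_addv : forall U es d (v w : forall x, V d x) n x, open U ->
    all_hsec U es -> bsec U v -> bsec U w -> U x ->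
    nabla U es (Hsec (fun y => v y + w y)) n x =
      nabla U es (Hsec v) n x + nabla U es (Hsec w) n x;
  cn_linearv : forall U es d (v : forall x, V d x) f n x, open U ->
    size es <> 1%N -> fs_O U f -> all_hsec U es -> bsec U v -> U x ->
    nabla U es (Hsec (fun y => f y *: v y)) n x =
      f x *: nabla U es (Hsec v) n x;
  cn_leibniz : forall U e d (v : forall x, V d x) f n x, open U ->
    fs_O U f -> is_hsec U e -> bsec U v -> U x ->
    nabla U [:: e] (Hsec (fun y => f y *: v y)) n x =
      f x *: nabla U [:: e] (Hsec v) n x +
      rho_ext (li_rho L) [:: at_pt x e] f *: tot (Hsec v) n x
}.

Definition operator E V := set X -> vform E V -> vform E V.

Record is_leibniz_operator E (Q : set X -> sform E -> sform E) V
    (D : operator E V) : Prop := {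
  op_section : forall U w, open U -> is_vform U w -> is_vform U (D U w);
  op_local : forall U U' w w', open U -> open U' -> U' `<=` U ->
    is_vform U w -> is_vform U' w' ->
    (forall x es v, U' x -> w x es v = w' x es v) ->
    forall x es v, U' x -> D U w x es v = D U' w' x es v;
  op_linear : forall U (c : K) w w', open U -> is_vform U w ->
    is_vform U w' -> forall x es v, U x ->
    D U (fun y fs u => c * w y fs u + w' y fs u) x es v =
      c * D U w x es v + D U w' x es v;
  op_degree : forall U w d, open U -> is_vform U w -> vform_deg U w d ->
    vform_deg U (D U w) (d + 1);
  op_leibniz : forall U xi w d, open U -> is_form U xi -> form_deg U xi d ->
    is_vform U w -> forall x es v, U x ->
    D U (fscale xi w) x es v =
      fscale (Q U xi) w x es v + (-1) ^ d * fscale xi (D U w) x es v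
}.

Definition eq_taylor E V (nabla nabla' : taylor E V) : Prop :=
  forall U es v, open U -> all_hsec U es -> is_hsec U v ->
  forall n x, U x -> nabla U es v n x = nabla' U es v n x.

Definition eq_operator E V (D D' : operator E V) : Prop :=
  forall U w, open U -> is_vform U w ->
  forall x es v, U x -> D U w x es v = D' U w x es v.

(* Gamma(V^* ) as the part 1 (x) Gamma(V^* ) of Gamma(S(E^* ) (x) V^* ) *)
Definition of_vdual E V (a : dsection V) : vform E V :=
  ftens (of_fun E (fun=> 1)) a.

#[global] Arguments of_vdual E {V} a x es v.
Definition corresponds E (L : lie_infty_algebroid E) V (nabla : taylor E V)
    (D : operator E V) : Prop :=
  forall U a d es v x, open U -> is_dual U a -> dual_deg U a d ->
  all_hsec U es -> is_hsec U v -> U x ->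
  D U (of_vdual E a) x (pts x es) (at_pt x v) =
    (-1) ^ d * dual_tot a d (nabla U es v) x +
    (-1) ^ (d + 1) * rho_ext (li_rho L) (pts x es) (dual_app a v).

End Graded.

(* R is a bijection between the elements of S satisfying P, up to eqS, and the
   elements of T satisfying Q, up to eqT. *)
Definition one_to_one (S T : Type) (P : S -> Prop) (eqS : S -> S -> Prop)
    (Q : T -> Prop) (eqT : T -> T -> Prop) (R : S -> T -> Prop) : Prop :=
  (forall s, P s -> exists t, [/\ Q t, R s t &
     forall t', Q t' -> R s t' -> eqT t' t]) /\
  (forall t, Q t -> exists s, [/\ P s, R s t &
     forall s', P s' -> R s' t -> eqS s' s]).

(* Main.v *)
Require Import Defs.
From mathcomp Require Import all_boot all_order all_algebra.
From mathcomp Require Import all_classical all_reals all_analysis.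
From mathcomp Require Import complex ring zify.

(* A connection and its operator are dual connections of each other.  From
   nabla, pairing a form w with a section v of V gives a form w(-, v) on E, and
     (D w)(es, v) = (-1)^|v| Q (w(-, v)) (es)
                    + sum over unshuffles of +- w(es', nabla_{es''} v),
   where the Leibniz defect of nabla in v cancels the one of Q, so that the
   right-hand side only depends on the value of v at the point; the sign in front
   of Q is the one that produces the anchor term of the correspondence.
   Conversely, D determines the functions <a, nabla_{es} v>, and these are
   O-linear in a because D(f a) = Q(f) a + f D(a) and Q(f) = - rho[f].  A Leibniz
   operator is determined by its values on V^*, since every w is locally a sum of
   products of homogeneous forms with sections of V^*.

   The forms on E are recognised as the graded symmetric, O-multilinear
   expressions of locally bounded word length with regular values: Euler's
   formula sum_i eps_i (.) (i_{e_i} F) = k F, for F of word length k and local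
   frames e_i of E and eps_i of E^*, expresses such an F as a sum of products in
   characteristic 0. *)

Set Implicit Arguments.
Unset Strict Implicit.
Unset Printing Implicit Defensive.

Import Order.TTheory GRing.Theory Num.Theory.

Local Open Scope classical_set_scope.
Local Open Scope ring_scope.

(** * Koszul signs and the shuffle product on words *)

(** Forms take words of vectors, whereas [nabla] and the formulas for Q take sections. Vectors are
    therefore extended with constant coefficients in a frame, and independence of the extension has
    to be proved: for the letters from E it is tensoriality of [nabla], while in the slot of V
    neither the Q term nor the [nabla] term is tensorial, only their sum. The Leibniz rules of Q and
    D are given for homogeneous forms only, and a general form mixes degrees. Since E is negatively
    graded and has finite rank, word length and degree bound each other; this gives local
    decompositions into finitely many homogeneous parts, and bounds the word length of the forms
    built from [nabla]. All sign computations are reduced to two operations on functions of words,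
    contraction with the first letter ([contr]) and multiplication by a sign depending on the degree
    of the word ([tw]). *)

Lemma big_tupleS (R : Type) (idx : R) (op : Monoid.com_law idx) (I : finType)
    (n : nat) (F : seq I -> R) :
  \big[op/idx]_(t : n.+1.-tuple I) F t =
  \big[op/idx]_i \big[op/idx]_(t : n.-tuple I) F (i :: t).
Proof.
rewrite pair_big /=.
rewrite (reindex (fun p : I * n.-tuple I => [tuple of p.1 :: p.2])) //=.
exists (fun t : n.+1.-tuple I => (thead t, [tuple of behead t])).
  by move=> [i t] _ /=; congr (_, _); apply: val_inj.
by move=> t _ /=; rewrite [RHS]tuple_eta; apply: val_inj.
Qed.

Section KoszulSign.
Variable K : fieldType.
Local Notation ks := (@ksign K).
Implicit Types a b c : int.

Lemma ksDl a b c : ks (a + b) c = ks a c * ks b c.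
Proof. by rewrite /ksign mulrDl expfzDr ?oppr_eq0 ?oner_eq0. Qed.

Lemma ksC a b : ks a b = ks b a.
Proof. by rewrite /ksign mulrC. Qed.

Lemma ksDr a b c : ks a (b + c) = ks a b * ks a c.
Proof. by rewrite !(ksC a) ksDl. Qed.

Lemma ks0 a : ks a 0 = 1.
Proof. by rewrite /ksign mulr0 expr0z. Qed.

Lemma ks0l a : ks 0 a = 1.
Proof. by rewrite ksC ks0. Qed.

Lemma ksNr a b : ks a (- b) = ks a b.
Proof. by rewrite /ksign mulrN -exprz_inv invrN invr1. Qed.

Lemma ksNl a b : ks (- a) b = ks a b.
Proof. by rewrite !(ksC _ b) ksNr. Qed.

Lemma ks_sq a b : ks a b * ks a b = 1.
Proof. by rewrite -{2}(ksNr a b) -ksDr subrr ks0. Qed.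

Lemma ks1 a : ks a 1 = (-1) ^ a.
Proof. by rewrite /ksign mulr1. Qed.

Lemma signzD a b : (-1) ^ (a + b) = (-1) ^ a * (-1) ^ b :> K.
Proof. by rewrite -!ks1 ksDl. Qed.

Lemma signz_sq a : (-1) ^ a * (-1) ^ a = 1 :> K.
Proof. by rewrite -!ks1 ks_sq. Qed.

Lemma signzN a : (-1) ^ (- a) = (-1) ^ a :> K.
Proof. by rewrite -!ks1 ksNl. Qed.

End KoszulSign.

Section Words.
Variables (K : fieldType) (X : fspace K) (E : gbundle X) (x : X).
Local Notation T := (hvec E x).
Local Notation ks := (@ksign K).
Implicit Types (F G H : seq T -> K) (e : T) (es : seq T) (a b : int).

Definition wdeg es : int := sdeg (vdegs es).

Lemma wdeg_nil : wdeg [::] = 0.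
Proof. by rewrite /wdeg /sdeg big_nil. Qed.

Lemma wdeg_cons e es : wdeg (e :: es) = tag e + wdeg es.
Proof. by rewrite /wdeg /sdeg /= big_cons. Qed.

Lemma wdeg_cat p q : wdeg (p ++ q) = wdeg p + wdeg q.
Proof. by rewrite /wdeg /sdeg /vdegs map_cat big_cat. Qed.

Lemma wdeg_mask (m : bitseq) es : size m = size es ->
  wdeg (mask m es) + wdeg (cmask m es) = wdeg es.
Proof.
move=> sz; rewrite /wdeg -(@sdeg_mask m (vdegs es)) ?size_map //.
by rewrite /vdegs /cmask !map_mask.
Qed.

(** This is [fmul] at one point, for arbitrary functions on words: the inductions pass from [F] to
    [contr e F], where [e] is a vector at [x] only. *)
Definition pmul F G es : K := \sum_(m : (size es).-tuple bool)
  ueps K m (vdegs es) * ks (wdeg (mask m es)) (wdeg (cmask m es)) *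
  F (mask m es) * G (cmask m es).

(** The Koszul sign for carrying an object of degree [a] past the whole argument word. *)
Definition tw a F es : K := ks (wdeg es) a * F es.
Definition contr e F es : K := F (e :: es).
Definition punit es : K := if es is [::] then 1 else 0.

Lemma pmul_nil F G : pmul F G [::] = F [::] * G [::].
Proof.
rewrite /pmul (big_pred1 [tuple]); first by rewrite /= wdeg_nil ks0 !mul1r.
by move=> t; apply/esym/eqP; apply: val_inj; case: t => -[].
Qed.

(* The signs of [ueps] and [ksign] collapse in this recursion, from which the
   algebra of the shuffle product follows by induction on the word. *)
Lemma pmul_cons F G e es :
  pmul F G (e :: es) =
  pmul (contr e F) (tw (tag e) G) es + pmul F (contr e G) es.
Proof.
rewrite {1}/pmul /= (big_tupleS _ _ (fun m : bitseq => ueps K m _ *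
  ks (wdeg (mask m (e :: es))) (wdeg (cmask m (e :: es))) *
  F (mask m (e :: es)) * G (cmask m (e :: es)))).
rewrite big_bool /=; congr (_ + _); apply: eq_bigr => m _ /=.
  by rewrite wdeg_cons ksDl /contr /tw (ksC _ (tag e)) /cmask; ring.
rewrite /cmask /= -/(cmask m es) wdeg_cons ksDr /contr.
rewrite -map_mask -/(vdegs _) -/(wdeg _) (ksC _ (wdeg _) (tag e)).
set A := ks _ _.
by rewrite -[RHS]mul1r -(ks_sq K (tag e) (wdeg (mask m es))) -/A; ring.
Qed.

(** The degree of a word is additive over an unshuffle, so [tw a] is multiplicative. *)
Lemma tw_pmul a F G : tw a (pmul F G) =1 pmul (tw a F) (tw a G).
Proof.
move=> es; rewrite /tw /pmul mulr_sumr; apply: eq_bigr => m _.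
by rewrite -(wdeg_mask (size_tuple m)) ksDl; ring.
Qed.

Lemma tw_sq a F : tw a (tw a F) =1 F.
Proof. by move=> es; rewrite /tw mulrA ks_sq mul1r. Qed.

Lemma tw_tw a b F : tw a (tw b F) =1 tw (a + b) F.
Proof. by move=> es; rewrite /tw mulrA ksDr. Qed.

Lemma eq_tw a F G : F =1 G -> tw a F =1 tw a G.
Proof. by move=> eqFG es; rewrite /tw eqFG. Qed.

Lemma eq_pmul F G F' G' : F =1 F' -> G =1 G' -> pmul F G =1 pmul F' G'.
Proof. by move=> /funext -> /funext ->. Qed.

Lemma pmul_linl (c : K) F F' G es :
  pmul (fun s => c * F s + F' s) G es = c * pmul F G es + pmul F' G es.
Proof.
by rewrite /pmul mulr_sumr -big_split; apply: eq_bigr => m _ /=; ring.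
Qed.

Lemma pmul_linr (c : K) F G G' es :
  pmul F (fun s => c * G s + G' s) es = c * pmul F G es + pmul F G' es.
Proof.
by rewrite /pmul mulr_sumr -big_split; apply: eq_bigr => m _ /=; ring.
Qed.

Lemma pmulZl (c : K) F G es : pmul (fun s => c * F s) G es = c * pmul F G es.
Proof. by rewrite /pmul mulr_sumr; apply: eq_bigr => m _ /=; ring. Qed.

Lemma pmulZr (c : K) F G es : pmul F (fun s => c * G s) es = c * pmul F G es.
Proof. by rewrite /pmul mulr_sumr; apply: eq_bigr => m _ /=; ring. Qed.

Lemma pmulDl F F' G es :
  pmul (fun s => F s + F' s) G es = pmul F G es + pmul F' G es.
Proof. by rewrite /pmul -big_split; apply: eq_bigr => m _ /=; ring. Qed.

Lemma pmulDr F G G' es :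
  pmul F (fun s => G s + G' s) es = pmul F G es + pmul F G' es.
Proof. by rewrite /pmul -big_split; apply: eq_bigr => m _ /=; ring. Qed.

Lemma pmul_suml (I : finType) (F : I -> seq T -> K) G es :
  pmul (fun s => \sum_i F i s) G es = \sum_i pmul (F i) G es.
Proof.
rewrite /pmul exchange_big; apply: eq_bigr => m _ /=.
by rewrite mulr_sumr mulr_suml.
Qed.

Lemma pmul_sumr (I : finType) F (G : I -> seq T -> K) es :
  pmul F (fun s => \sum_i G i s) es = \sum_i pmul F (G i) es.
Proof. by rewrite /pmul exchange_big; apply: eq_bigr => m _; rewrite mulr_sumr. Qed.

Lemma pmul0l G es : pmul (fun=> 0) G es = 0.
Proof. by apply: big1 => m _; rewrite mulr0 mul0r. Qed.

Lemma tw_contr a e F : contr e (tw a F) =1 (fun s => ks (tag e) a * tw a (contr e F) s).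
Proof. by move=> es; rewrite /contr /tw wdeg_cons ksDl mulrA. Qed.

Lemma contr_pmul e F G : contr e (pmul F G) =1
  (fun s => pmul (contr e F) (tw (tag e) G) s + pmul F (contr e G) s).
Proof. by move=> es; apply: pmul_cons. Qed.

(** Contraction is a twisted derivation and [tw] is multiplicative, so both sides satisfy the same
    recursion in the first letter. *)
Lemma pmulA F G H : pmul (pmul F G) H =1 pmul F (pmul G H).
Proof.
move=> es; elim: es F G H => [|e es IH] F G H.
  by rewrite !pmul_nil mulrA.
rewrite !pmul_cons (eq_pmul (contr_pmul e F G) (frefl _)) pmulDl !IH.
rewrite (eq_pmul (frefl _) (contr_pmul e G H)) pmulDr.
by rewrite (eq_pmul (frefl _) (tw_pmul (tag e) G H)) addrA.
Qed.

Lemma pmul1l F : pmul punit F =1 F.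
Proof.
move=> es; elim: es F => [|e es IH] F; first by rewrite pmul_nil mul1r.
by rewrite pmul_cons IH (_ : contr e punit = fun=> 0) ?pmul0l ?add0r.
Qed.

Lemma pmul_fun (c : K) (F : seq T -> K) :
  pmul (fun s => if s is [::] then c else 0) F =1 (fun s => c * F s).
Proof.
move=> es; rewrite -(pmul1l F es) -pmulZl; congr pmul.
by apply: funext => -[|? ?] /=; rewrite ?mulr1 ?mulr0.
Qed.

Definition pdeg F a := forall es, F es != 0 -> wdeg es = - a.

Lemma pdeg_contr F a e : pdeg F a -> pdeg (contr e F) (a + tag e).
Proof. by move=> dF es /dF; rewrite wdeg_cons => h; lia. Qed.

Lemma pdeg_tw F a b : pdeg F a -> tw b F =1 (fun s => ks a b * F s).
Proof.
move=> dF es; rewrite /tw; have [->|/dF ->] := eqVneq (F es) 0.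
  by rewrite !mulr0.
by rewrite ksNl.
Qed.

(** Putting the sign into [tw a G] leaves [G] inhomogeneous; contraction with [e] shifts the degree
    of [F] by that of [e], which keeps the induction going. *)
Lemma pmulC F G a : pdeg F a -> pmul F G =1 pmul (tw a G) F.
Proof.
move=> + es; elim: es F G a => [|e es IH] F G a dF.
  by rewrite !pmul_nil /tw wdeg_nil ks0l mul1r mulrC.
rewrite !pmul_cons (IH _ _ _ (pdeg_contr (e := e) dF)) (IH _ _ _ dF) addrC.
rewrite (eq_pmul (tw_contr a e G) (pdeg_tw _ dF)) pmulZl pmulZr mulrA.
rewrite (ksC _ a) ks_sq mul1r; congr (_ + _); apply: eq_pmul => // s.
by rewrite /tw mulrA -ksDr -addrA ksDr ksDr ks_sq mulr1.
Qed.

Definition psym F := forall (p : seq T) (a b : T) (q : seq T),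
  F (p ++ a :: b :: q) = ks (tag a) (tag b) * F (p ++ b :: a :: q).

Lemma psym_contr e F : psym F -> psym (contr e F).
Proof. by move=> sF p a b q; apply: (sF (e :: p)). Qed.

Lemma psym_tw a F : psym F -> psym (tw a F).
Proof.
move=> sF p u v q; rewrite /tw sF mulrCA; congr (_ * (ks _ _ * _)).
by rewrite !wdeg_cat !wdeg_cons (addrCA (tag u)).
Qed.

(** Peeling off the two letters gives four terms. Those with both letters in the same factor use the
    symmetry of that factor; the two mixed ones are exchanged by the swap. *)
Lemma psym_pmul F G : psym F -> psym G -> psym (pmul F G).
Proof.
move=> sF sG p a b q; elim: p F G sF sG => [|c p IH] F G sF sG; last first.
  rewrite !cat_cons !pmul_cons mulrDr; congr (_ + _); apply: IH => //.
  - exact: psym_contr.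
  - exact: psym_tw.
  - exact: psym_contr.
rewrite /= !pmul_cons.
rewrite (eq_pmul (frefl _) (tw_contr (tag a) b G)) pmulZr.
rewrite (eq_pmul (frefl _) (tw_contr (tag b) a G)) pmulZr.
have eF : contr b (contr a F) =1
    (fun s => ks (tag a) (tag b) * contr a (contr b F) s).
  by move=> s; apply: (sF [::]).
have eG : contr b (contr a G) =1
    (fun s => ks (tag a) (tag b) * contr a (contr b G) s).
  by move=> s; apply: (sG [::]).
rewrite (eq_pmul (frefl F) eG) pmulZr.
rewrite (eq_pmul eF (tw_tw (tag b) (tag a) G)) pmulZl.
rewrite (eq_pmul (frefl (contr a (contr b F))) (tw_tw (tag a) (tag b) G)).
rewrite (addrC (tag b)) (ksC _ (tag b)) !mulrDr !mulrA ks_sq !mul1r.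
by rewrite -!addrA; congr (_ + _); rewrite addrCA.
Qed.

Definition pmlin F := forall (p : seq T) n (c : K) (u v : E n x) (q : seq T),
  F (p ++ Hvec (c *: u + v) :: q) = c * F (p ++ Hvec u :: q) + F (p ++ Hvec v :: q).

Lemma pmlin_contr e F : pmlin F -> pmlin (contr e F).
Proof. by move=> lF p; apply: (lF (e :: p)). Qed.

Lemma pmlin_tw a F : pmlin F -> pmlin (tw a F).
Proof. by move=> lF p n c u v q; rewrite /tw lF !wdeg_cat !wdeg_cons /=; ring. Qed.

Lemma pmlin_pmul F G : pmlin F -> pmlin G -> pmlin (pmul F G).
Proof.
move=> lF lG p n c u v q; elim: p F G lF lG => [|d p IH] F G lF lG; last first.
  rewrite !cat_cons !pmul_cons !IH; first by ring.
  - exact: lF.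
  - exact: pmlin_contr.
  - exact: pmlin_contr.
  - exact: pmlin_tw.
rewrite /= !pmul_cons /=.
have eF : contr (Hvec (c *: u + v)) F =1
    (fun s => c * contr (Hvec u) F s + contr (Hvec v) F s).
  by move=> s; apply: (lF [::]).
have eG : contr (Hvec (c *: u + v)) G =1
    (fun s => c * contr (Hvec u) G s + contr (Hvec v) G s).
  by move=> s; apply: (lG [::]).
rewrite (eq_pmul eF (frefl _)) (eq_pmul (frefl _) eG) pmul_linl pmul_linr.
by ring.
Qed.

Lemma pmlin0 F p n q : pmlin F -> F (p ++ Hvec (0 : E n x) :: q) = 0.
Proof.
move=> lF; have := lF p n 1 0 0 q; rewrite scaler0 addr0 mul1r => h.
by apply/eqP; rewrite -(subrr (F (p ++ Hvec (0 : E n x) :: q))) {2}h addrK.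
Qed.

Lemma pmul_letter (f : T -> K) G e es :
  pmul (fun s => if s is [:: u] then f u else 0) G (e :: es) =
  f e * tw (tag e) G es +
  pmul (fun s => if s is [:: u] then f u else 0) (contr e G) es.
Proof.
rewrite pmul_cons; congr (_ + _); rewrite -(pmul_fun (f e)).
by apply: eq_pmul => // -[|? []].
Qed.

End Words.

Arguments pmulC {K X E x F} G {a} _ _.

(** * Sheaves of functions, sections and local frames *)

Section Sheaf.
Variables (K : fieldType) (X : fspace K).
Implicit Types (U W : set X) (f g : X -> K) (x : X).

Lemma fs_scale U (c : K) f : open U -> fs_O U f -> fs_O U (fun x => c * f x).
Proof. by move=> oU fU; exact: fs_mul oU (fs_cst c oU) fU. Qed.

Lemma fs_linear U (c : K) f g : open U -> fs_O U f -> fs_O U g ->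
  fs_O U (fun x => c * f x + g x).
Proof. by move=> oU fU gU; apply: fs_add => //; apply: fs_scale. Qed.

Lemma finite_shrink (I : finType) (P : I -> set X -> Prop) x :
  (forall i W W', open W' -> W' `<=` W -> P i W -> P i W') ->
  (forall i, exists W, [/\ open W, W x & P i W]) ->
  exists W, [/\ open W, W x & forall i, P i W].
Proof.
move=> mono ex; suff [W [oW Wx PW]] : exists W, [/\ open W, W x &
    forall i, i \in enum I -> P i W].
  by exists W; split=> // i; apply: PW; rewrite mem_enum.
elim: (enum I) => [|i s [W [oW Wx PW]]]; first by exists setT; split=> //; exact: openT.
have [W' [oW' W'x PW']] := ex i; exists (W `&` W').
have oI := openI oW oW'; split=> // j; rewrite inE => /predU1P[->|/PW].
  by apply: mono PW' => // y [].
by apply: mono => // y [].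
Qed.

(** * Sections of a vector bundle and their coordinates in a local frame *)

Section Bsec.
Variable B : vbundle X.
Implicit Types s t : forall x, B x.

Lemma bsec_ext U s t : (forall x, U x -> s x = t x) -> bsec U s -> bsec U t.
Proof.
move=> st bs A FA; have [f [fO sE]] := bs A FA; exists f; split=> // x Ux Ax.
by rewrite -st // sE.
Qed.

Lemma bsec_restr U U' s : open U -> open U' -> U' `<=` U -> bsec U s -> bsec U' s.
Proof.
move=> oU oU' UU bs A FA; have [f [fO sE]] := bs A FA.
have oA : open (lf_dom A) by have [] := vb_frame FA.
exists f; split=> [i|x Ux Ax]; last by apply: sE => //; apply: UU.
apply: fs_restr (fO i); try exact: openI.
by move=> x [Ux Ax]; split=> //; apply: UU.
Qed.

Lemma bsec0 U : open U -> bsec U (fun x => 0 : B x).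
Proof.
move=> oU A FA; have oA : open (lf_dom A) by have [] := vb_frame FA.
exists (fun _ _ => 0); split=> [i|x _ _]; first by apply: fs_cst; exact: openI.
by rewrite big1 // => i _; rewrite scale0r.
Qed.

Lemma bsecD U s t : open U -> bsec U s -> bsec U t ->
  bsec U (fun x => s x + t x).
Proof.
move=> oU bs bt A FA; have oA : open (lf_dom A) by have [] := vb_frame FA.
have [f [fO sE]] := bs A FA; have [g [gO tE]] := bt A FA.
exists (fun i x => f i x + g i x); split=> [i|x Ux Ax].
  by apply: fs_add => //; exact: openI.
by rewrite sE // tE // -big_split; apply: eq_bigr => i _; rewrite scalerDl.
Qed.

Lemma bsecZ U f s : open U -> fs_O U f -> bsec U s ->
  bsec U (fun x => f x *: s x).
Proof.
move=> oU fU bs A FA; have oA : open (lf_dom A) by have [] := vb_frame FA.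
have [g [gO sE]] := bs A FA.
exists (fun i x => f x * g i x); split=> [i|x Ux Ax].
  apply: fs_mul => //; first exact: openI.
  by apply: (fs_restr oU _ _ fU); [exact: openI | move=> ? []].
by rewrite sE // scaler_sumr; apply: eq_bigr => i _; rewrite scalerA.
Qed.

Lemma bsec_sum (I : finType) U (s : I -> forall x, B x) : open U ->
  (forall i, bsec U (s i)) -> bsec U (fun x => \sum_i s i x).
Proof.
move=> oU bs; apply: (bsec_ext (s := fun x => \sum_(i <- index_enum I) s i x)) => //.
elim: (index_enum I) => [|i r IH].
  by apply: (bsec_ext (s := fun=> 0)) (bsec0 oU) => // x _; rewrite big_nil.
apply: (bsec_ext (s := fun x => s i x + \sum_(j <- r) s j x)) (bsecD oU (bs i) IH).
by move=> x _; rewrite big_cons.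
Qed.

(** Since [coord] is total, this is linear in [u] at every point, but it is a coordinate only over
    [lf_dom A], where the sections form a basis. *)
Definition lcoord (A : lframe B) (i : 'I_(lf_rank A)) x (u : B x) : K :=
  coord (mktuple (fun i : 'I_(lf_rank A) => @lf_sec _ _ _ A i x)) i u.

Lemma lcoord_linear (A : lframe B) (i : 'I_(lf_rank A)) x c (u v : B x) :
  lcoord i (c *: u + v) = c * lcoord i u + lcoord i v.
Proof. by rewrite /lcoord linearP. Qed.

Lemma lframe_nth (A : lframe B) x (i : 'I_(lf_rank A)) :
  (mktuple (fun i : 'I_(lf_rank A) => @lf_sec _ _ _ A i x))`_i = @lf_sec _ _ _ A i x.
Proof. by rewrite -tnth_nth tnth_mktuple. Qed.

Lemma lcoordE (A : lframe B) x (u : B x) : vb_frames A -> lf_dom A x ->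
  u = \sum_i lcoord i u *: @lf_sec _ _ _ A i x.
Proof.
move=> FA Ax; have [_ /(_ x Ax) bA] := vb_frame FA.
rewrite {1}(coord_basis (X := mktuple (fun i : 'I_(lf_rank A) => @lf_sec _ _ _ A i x)) bA (memvf u)).
by apply: eq_bigr => i _; rewrite lframe_nth.
Qed.

(** The frame is free over its domain, so the coordinates coincide with the regular coefficients
    that [frame_section] provides for [A] itself. *)
Lemma lcoord_regular (A : lframe B) i U s : open U -> vb_frames A ->
  U `<=` lf_dom A -> bsec U s -> fs_O U (fun x => @lcoord A i x (s x)).
Proof.
move=> oU FA UA bs; have [oA bA] := vb_frame FA.
have [f [fO sE]] := bs A FA.
have e : U `&` lf_dom A = U by apply/seteqP; split=> [x []|x Ux] //; split=> //; apply: UA.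
apply: (fs_ext (f := f i)) => //; last by rewrite -{1}e.
move=> x Ux; have Ax := UA x Ux; rewrite sE // /lcoord.
under eq_bigr do rewrite -lframe_nth.
by rewrite coord_sum_free // (basis_free (bA x Ax)).
Qed.

End Bsec.

(** * Local frames of graded bundles and their dual sections *)

Section GFrames.
Variable B : gbundle X.
Implicit Types (e : hsec B).

Lemma untag_Hvec (R : Type) (idx : R) n x (u : B n x) (F : B n x -> R) :
  untag (T_ := fun n => B n x) idx F (Hvec u) = F u.
Proof. by rewrite (@untagE _ (fun n => B n x) R idx n F (Hvec u) erefl). Qed.

Lemma Hvec_inj n x : injective (@Hvec K X B x n).
Proof. by move=> u v e; rewrite -[u](untag_Hvec 0 u id) e untag_Hvec. Qed.

Lemma tot_Hsec n (s : forall x, B n x) x : tot (Hsec s) n x = s x.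
Proof. by rewrite /tot /at_pt /= untag_Hvec. Qed.

Lemma tot_out e n x : tag e != n -> tot e n x = 0.
Proof. by move=> ne; rewrite /tot (@untag_dflt _ (fun n => B n x)). Qed.

Lemma tot_tag e x : tot e (tag e) x = projT2 e x.
Proof. by case: e => n s; exact: tot_Hsec. Qed.

Lemma at_pt_tot e n x : tag e = n -> Hvec (tot e n x) = at_pt x e.
Proof. by move=> <-; rewrite tot_tag. Qed.

Lemma tot_bsec U e n : open U -> is_hsec U e -> bsec U (tot e n).
Proof.
move=> oU eU; have [en|ne] := eqVneq (tag e) n.
  by rewrite -en; apply: (bsec_ext (s := projT2 e)) => // x _; rewrite tot_tag.
by apply: (bsec_ext (s := fun=> 0)) (bsec0 oU) => x _; rewrite tot_out.
Qed.

Lemma at_pt_inj e e' x : at_pt x e = at_pt x e' ->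
  tag e = tag e' /\ forall n, tot e n x = tot e' n x.
Proof.
move=> h; split=> [|n]; last by rewrite /tot h.
exact: (congr1 tag h).
Qed.

Lemma hsec_restr U U' e : open U -> open U' -> U' `<=` U ->
  is_hsec U e -> is_hsec U' e.
Proof. exact: bsec_restr. Qed.

Lemma dual_restr U U' (a : dsection B) : U' `<=` U -> is_dual U a -> is_dual U' a.
Proof.
move=> UU [la ra]; split=> [x n c u v Ux|W n s oW WU]; first by apply: la; apply: UU.
by apply: ra => // x /WU /UU.
Qed.

Lemma dual_deg_restr U U' (a : dsection B) d :
  U' `<=` U -> dual_deg U a d -> dual_deg U' a d.
Proof. by move=> UU da x v /UU; apply: da. Qed.

Record gframe := GFrame {
  gf_idx : finType; gf_sec : gf_idx -> hsec B; gf_dual : gf_idx -> dsection B }.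

(* A finite family of sections and dual sections resolving the identity; no
   linear independence is asked for. *)
Record is_gframe (W : set X) (F : gframe) : Prop := {
  gf_sec_ok : forall i, is_hsec W (@gf_sec F i);
  gf_dual_ok : forall i, is_dual W (@gf_dual F i);
  gf_deg : forall i, dual_deg W (@gf_dual F i) (- tag (@gf_sec F i));
  gf_resol : forall x n (u : B n x), W x ->
    u = \sum_i @gf_dual F i x (Hvec u) *: tot (@gf_sec F i) n x }.

Lemma is_gframe_restr W W' F : open W -> open W' -> W' `<=` W ->
  is_gframe W F -> is_gframe W' F.
Proof.
move=> oW oW' WW [h1 h2 h3 h4]; split=> [i|i|i|x n u /WW]; last exact: h4.
- exact: hsec_restr (h1 i).
- exact: dual_restr (h2 i).
- exact: dual_deg_restr (h3 i).
Qed.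

Definition cdual n (A : lframe (B n)) (i : 'I_(lf_rank A)) : dsection B :=
  fun x h => untag (T_ := fun n => B n x) 0 (fun u : B n x => lcoord i u) h.

Lemma cdual_dual n (A : lframe (B n)) i U : vb_frames A -> open U ->
  U `<=` lf_dom A -> is_dual U (@cdual n A i).
Proof.
move=> FA oU UA; split=> [x m c u v Ux|U' m s oU' UU bs].
  have [e|ne] := eqVneq m n; last by rewrite /cdual !untag_dflt // mulr0 addr0.
  by subst m; rewrite /cdual !untag_Hvec lcoord_linear.
have [e|ne] := eqVneq m n.
  subst m; apply: (fs_ext (f := fun x => lcoord i (s x))) => //.
    by move=> x _; rewrite /cdual untag_Hvec.
  by apply: lcoord_regular => // x /UU/UA.
apply: (fs_ext (f := fun=> 0)) (fs_cst 0 oU') => // x _.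
by rewrite /cdual untag_dflt.
Qed.

Lemma cdual_deg n (A : lframe (B n)) i U : dual_deg U (@cdual n A i) (- n).
Proof.
move=> x v _; rewrite opprK; have [//|ne] := eqVneq (tag v) n.
by rewrite /cdual untag_dflt ?eqxx.
Qed.

Lemma gb_vanish : exists N : nat, forall n x (u : B n x), (N < `|n|)%N -> u = 0.
Proof.
have [N hN] := gb_finite B; exists N => n x u /(hN n x)/eqP.
by rewrite dimv_eq0 => /eqP e; apply/eqP; rewrite -memv0 -e memvf.
Qed.

Lemma gframe_exists x : exists (W : set X) (F : gframe), [/\ open W, W x & is_gframe W F].
Proof.
have [N hN] := gb_vanish.
(* [dg] runs through the degrees from [-N] to [N], outside of which all fibres vanish; one bundle
   frame is chosen for each of them. *)
pose dg (k : 'I_(N + N).+1) : int := (k : nat)%:Z - N%:Z.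
have hA k : exists A : lframe (B (dg k)), vb_frames A /\ lf_dom A x.
  by have [A FA Ax] := vb_cover (B (dg k)) x; exists A.
pose A k := sval (cid (hA k)).
have FA k : vb_frames (A k) by rewrite /A; case: cid => ? [].
have Ax k : lf_dom (A k) x by rewrite /A; case: cid => ? [].
have [W [oW Wx WA]] : exists W, [/\ open W, W x & forall k, W `<=` lf_dom (A k)].
  apply: finite_shrink => [k W W' _ WW' h y /WW' /h //|k].
  by exists (lf_dom (A k)); split=> //; have [] := vb_frame (FA k).
pose F := @GFrame {k : 'I_(N + N).+1 & 'I_(lf_rank (A k))}
  (fun i => Hsec (@lf_sec _ _ _ (A (tag i)) (tagged i)))
  (fun i => cdual (A := A (tag i)) (tagged i)).
exists W, F; split=> //; split=> [i|i|i|y n u Wy].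
- apply: (bsec_restr _ oW (WA (tag i)) (vb_compat _ (FA (tag i)))).
  by have [] := vb_frame (FA (tag i)).
- exact: (@cdual_dual _ (A (tag i)) (tagged i) W (FA _) oW (WA _)).
- exact: (@cdual_deg _ (A (tag i)) (tagged i) W).
have [/hN e|] := ltnP N `|n|%N.
  rewrite (e y u) big1 // => i _; rewrite (e y (tot _ _ _)) scaler0 //.
move=> nN; have hk : (absz (n + N%:Z)%R < (N + N).+1)%N by lia.
have [k dk] : exists k, dg k = n by exists (Ordinal hk); rewrite /dg /=; lia.
subst n.
rewrite {1}(lcoordE u (FA k) (WA _ _ Wy)).
rewrite -(sig_big_dep xpredT (fun _ => xpredT) (fun (k : 'I_(N + N).+1)
  (i : 'I_(lf_rank (A k))) => cdual i (Hvec u) *: tot (Hsec (lf_sec i)) _ y)).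
rewrite (bigD1 k) //= [X in _ = _ + X]big1 ?addr0.
  by apply: eq_bigr => i _; rewrite /cdual untag_Hvec tot_Hsec.
move=> k' nk; apply: big1 => i _; rewrite /cdual untag_dflt ?scale0r //=.
apply: contraNneq nk => h; apply/eqP/val_inj; move: h; rewrite /dg /=; lia.
Qed.
End GFrames.
End Sheaf.

Arguments bsec0 {K X B U} _.
Arguments bsecD {K X B U s t} _ _ _.
Arguments bsecZ {K X B U f s} _ _ _.
Arguments bsec_sum {K X B I U} s _ _.
Arguments bsec_ext {K X B U} s {t} _ _.
Arguments bsec_restr {K X B} U {U' s} _ _ _ _.
Arguments tot_bsec {K X B U e} n _ _.
Arguments gf_sec_ok {K X B W F} _ i.

(** * Extension of vectors to sections and tensoriality *)

Section Extension.
Variables (K : fieldType) (X : fspace K) (B : gbundle X).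
Implicit Types (U W : set X) (x : X) (e : hsec B) (es : seq (hsec B)).

Definition hlin x (g : hvec B x -> K) := forall n (c : K) (u v : B n x),
  g (Hvec (c *: u + v)) = c * g (Hvec u) + g (Hvec v).

Lemma hlin0 x g n : @hlin x g -> g (Hvec (0 : B n x)) = 0.
Proof.
move=> lg; have := lg n 1 0 0; rewrite scaler0 addr0 mul1r => h.
by apply/eqP; rewrite -(subrr (g (Hvec (0 : B n x)))) {2}h addrK.
Qed.

Lemma hlin_sum x g n (I : finType) (c : I -> K) (u : I -> B n x) : hlin g ->
  g (Hvec (\sum_i c i *: u i)) = \sum_i c i * g (Hvec (u i)).
Proof.
move=> lg; elim/big_rec2 : _ => [|i y1 y2 _ IH]; first exact: hlin0.
by rewrite lg IH.
Qed.

Lemma gframe_expand W (F : gframe B) x (g : hvec B x -> K) h :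
  is_gframe W F -> W x -> hlin g ->
  g h = \sum_i @gf_dual _ _ _ F i x h * g (at_pt x (@gf_sec _ _ _ F i)).
Proof.
case: h => n u fF Wx lg; rewrite -/(Hvec u).
rewrite {1}(gf_resol fF u Wx) hlin_sum //; apply: eq_bigr => i _.
(* A nonzero coefficient forces [gf_sec i] into the degree of [u], where its component is the whole
   section. *)
have [->|/(gf_deg fF Wx)] := eqVneq (gf_dual i (Hvec u)) 0; first by rewrite !mul0r.
by rewrite opprK /= => e; rewrite at_pt_tot.
Qed.

Lemma dual_hlin U (a : dsection B) x : is_dual U a -> U x -> hlin (a x).
Proof. by move=> [la _] Ux n c u v; apply: la. Qed.

Lemma dual_app_regular U U' (a : dsection B) e : open U' -> U' `<=` U ->
  is_dual U a -> is_hsec U' e -> fs_O U' (dual_app a e).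
Proof. by move=> oU' UU [_ ra] he; apply: ra. Qed.

Lemma dual_degN U (a : dsection B) d x (h : hvec B x) :
  dual_deg U a d -> U x -> tag h != - d -> a x h = 0.
Proof. by move=> da Ux; apply: contraNeq => /(da x h Ux) ->. Qed.

Definition fr_spec x := cid (gframe_exists B x).
Definition fr_dom x : set X := sval (fr_spec x).
Definition fr x : gframe B := sval (cid (svalP (fr_spec x))).

Lemma fr_open x : open (fr_dom x).
Proof. by rewrite /fr_dom; case: (svalP (fr_spec x)) => F []. Qed.

Lemma fr_mem x : fr_dom x x.
Proof. by rewrite /fr_dom; case: (svalP (fr_spec x)) => F []. Qed.

Lemma fr_ok x : is_gframe (fr_dom x) (fr x).
Proof. by have [] := svalP (cid (svalP (fr_spec x))). Qed.

(** The coefficients of [h] in the frame around [x] are frozen; the result is a section over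
    [fr_dom x] and in general not beyond. *)
Definition extend x (h : hvec B x) : hsec B :=
  Hsec (fun y => \sum_i @gf_dual _ _ _ (fr x) i x h *: tot (gf_sec i) (tag h) y).

Lemma at_pt_extend x (h : hvec B x) : at_pt x (extend h) = h.
Proof.
by case: h => n u; rewrite [RHS](congr1 (@Hvec _ _ _ _ _) (gf_resol (fr_ok x) u (fr_mem x))).
Qed.

Lemma extend_hsec x (h : hvec B x) : is_hsec (fr_dom x) (extend h).
Proof.
apply: bsec_sum => [|i]; first exact: fr_open.
apply: bsecZ; [exact: fr_open | exact: fs_cst (fr_open x) |].
by apply: tot_bsec; [exact: fr_open | exact: (gf_sec_ok (fr_ok x))].
Qed.

Lemma all_hsec_cons U e es : all_hsec U (e :: es) <-> is_hsec U e /\ all_hsec U es.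
Proof.
split=> [h|[he hes]].
  split; first exact: (h [::] e es).
  by move=> p f q es_eq; apply: (h (e :: p) f q); rewrite es_eq.
by case=> [|f p] g q [e_eq es_eq]; [rewrite -e_eq | apply: (hes p g q)].
Qed.

Lemma all_hsec_nil U : all_hsec U ([::] : seq (hsec B)).
Proof. by case. Qed.

Lemma all_hsec_cat U p q :
  all_hsec U (p ++ q : seq (hsec B)) <-> all_hsec U p /\ all_hsec U q.
Proof.
elim: p => [|e p IH]; first by split=> [|[]//]; split=> //; exact: all_hsec_nil.
by rewrite cat_cons !all_hsec_cons IH; tauto.
Qed.

Lemma all_hsec_restr U U' es : open U -> open U' -> U' `<=` U ->
  all_hsec U es -> all_hsec U' es.
Proof. by move=> oU oU' UU h p e q /h; apply: hsec_restr. Qed.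

Lemma all_hsec_extend x (hs : seq (hvec B x)) :
  all_hsec (fr_dom x) [seq extend h | h <- hs].
Proof.
elim: hs => [|h hs IH]; first exact: all_hsec_nil.
by apply/all_hsec_cons; split=> //; exact: (@extend_hsec x h).
Qed.

Arguments extend_hsec : clear implicits.
Arguments all_hsec_extend : clear implicits.

Lemma open_frI U x : open U -> open (U `&` fr_dom x).
Proof. by move=> oU; apply: openI => //; exact: fr_open. Qed.

Lemma extend_hsecI U x (h : hvec B x) : open U -> is_hsec (U `&` fr_dom x) (extend h).
Proof.
move=> oU; apply: hsec_restr (extend_hsec x h); first exact: fr_open.
  exact: open_frI.
by move=> y [].
Qed.

Lemma all_hsec_extendI U x (hs : seq (hvec B x)) : open U ->
  all_hsec (U `&` fr_dom x) [seq extend h | h <- hs].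
Proof.
move=> oU; apply: all_hsec_restr (all_hsec_extend x hs); first exact: fr_open.
  exact: open_frI.
by move=> y [].
Qed.

Lemma pts_extend x (hs : seq (hvec B x)) : pts x [seq extend h | h <- hs] = hs.
Proof.
by elim: hs => //= h hs ->; rewrite at_pt_extend.
Qed.

Lemma vdegs_pts x es : vdegs (pts x es) = degs es.
Proof. by rewrite /vdegs /pts -map_comp. Qed.

Lemma wdeg_pts x es : wdeg (pts x es) = sdeg (degs es).
Proof. by rewrite /wdeg vdegs_pts. Qed.

Lemma pts_cat x es es' : pts x (es ++ es') = pts x es ++ pts x es'.
Proof. exact: map_cat. Qed.

(** Tensoriality without cut-off functions: compatibility with restriction replaces them. The target
    [M] is left open because the lemma serves both the slots of [nabla] in E, with values in a fibre
    of V, and the slot of [dualc] in V, with scalar values. *)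
Lemma slot_tensor (M : lmodType K) x U d
    (G : set X -> (forall y, B d y) -> M) : open U -> U x ->
  (forall W W' s t, open W -> open W' -> W' `<=` W -> W `<=` U -> W' x ->
     bsec W s -> bsec W' t -> (forall y, W' y -> s y = t y) -> G W s = G W' t) ->
  (forall W s t, open W -> W `<=` U -> W x -> bsec W s -> bsec W t ->
     G W (fun y => s y + t y) = G W s + G W t) ->
  (forall W f s, open W -> W `<=` U -> W x -> fs_O W f -> bsec W s ->
     G W (fun y => f y *: s y) = f x *: G W s) ->
  forall W W' s t, open W -> open W' -> W `<=` U -> W' `<=` U -> W x -> W' x ->
    bsec W s -> bsec W' t -> s x = t x -> G W s = G W' t.
Proof.
move=> oU Ux Gloc Gadd Glin W W' s t oW oW' WU W'U Wx W'x bs bt st.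
(* In a local frame, G is a combination of fixed vectors whose coefficients are
   those of the section at x. *)
pose V := fr_dom x `&` (W `&` W').
have oV : open V := openI (fr_open x) (openI oW oW').
have VU : V `<=` U by move=> y [_ []] /WU.
have Vx : V x by split=> //; exact: fr_mem.
have fV : is_gframe V (fr x).
  by apply: is_gframe_restr (fr_ok x) => //; [exact: fr_open | move=> y []].
suff H Z r : open Z -> V `<=` Z -> Z `<=` U -> bsec Z r -> G Z r =
    \sum_i gf_dual i (Hvec (r x)) *: G V (tot (@gf_sec _ _ _ (fr x) i) d).
  rewrite (H W s) // ?(H W' t) //; last by move=> y [_ []].
    by apply: eq_bigr => i _; rewrite st.
  by move=> y [_ []].
move=> oZ VZ ZU br.
have bsi i : bsec V (tot (@gf_sec _ _ _ (fr x) i) d).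
  by apply: tot_bsec => //; exact: (gf_sec_ok fV).
have brV : bsec V r by apply: bsec_restr br.
have fi i : fs_O V (fun y => @gf_dual _ _ _ (fr x) i y (Hvec (r y))).
  by have [_ /(_ V d r oV)] := gf_dual_ok fV i; apply.
(* Additivity is given for two sections at a time, so the frame expansion is built up index by
   index, and every partial sum has to be a section. *)
pose S (l : seq (gf_idx (fr x))) y :=
  \sum_(i <- l) gf_dual i (Hvec (r y)) *: tot (gf_sec i) d y.
have bS l : bsec V (S l).
  elim: l => [|i l IH].
    by apply: (bsec_ext (fun=> 0)) (bsec0 oV) => y _; rewrite /S big_nil.
  apply: (bsec_ext _ _ (bsecD oV (bsecZ oV (fi i) (bsi i)) IH)) => y _.
  by rewrite /S big_cons.
rewrite (Gloc Z V r (S (index_enum _))) //; last first.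
  by move=> y Vy; rewrite /S -(gf_resol fV).
elim: (index_enum _) => [|i l IH].
  rewrite big_nil -(scale0r (G V (fun=> 0))) -(Glin V (fun=> 0)) //.
  - by apply: Gloc => // [|y _]; [exact: bsecZ (fs_cst 0 oV) (bsec0 oV)|
      rewrite /S big_nil scale0r].
  - exact: fs_cst.
  - exact: bsec0.
rewrite big_cons -IH -(Glin V (fun y => gf_dual i (Hvec (r y)))) //.
have bi := bsecZ oV (fi i) (bsi i); rewrite -Gadd //.
apply: Gloc => //; first exact: bsecD.
by move=> y _; rewrite /S big_cons.
Qed.

End Extension.

Arguments extend_hsec {K X B x} h.
Arguments all_hsec_extend {K X B x} hs.
Arguments extend_hsecI {K X B U x} h _.
Arguments all_hsec_extendI {K X B U x} hs _.
Arguments open_frI {K X} B {U} x _.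
Arguments all_hsec_nil {K X B} U.

(** * Forms as symmetric multilinear expressions *)

Section Forms.
Variables (K : fieldType) (X : fspace K) (E : gbundle X).
Implicit Types (U W : set X) (x : X) (F G : sform E) (f : X -> K).
Local Notation ks := (@ksign K).

Lemma fmulE F G x es : fmul F G x es = pmul (F x) (G x) es.
Proof. by []. Qed.

Definition freg U F := forall es, all_hsec U es -> fs_O U (fun x => F x (pts x es)).

Definition fbounded N x F := forall es, (N < size es)%N -> F x es = 0.

(* The multilinear description of [is_form]; the two agree in
   characteristic 0. *)
Record is_smf U F : Prop := {
  smf_sym : forall x, U x -> psym (F x);
  smf_lin : forall x, U x -> pmlin (F x);
  smf_reg : forall U', open U' -> U' `<=` U -> freg U' F;
  smf_bound : forall x, U x -> exists W N,
    [/\ open W, W x & forall y, W y -> fbounded N y F] }.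

Lemma smf_restr U U' F : U' `<=` U -> is_smf U F -> is_smf U' F.
Proof.
move=> UU [h1 h2 h3 h4]; split=> [x /UU|x /UU|W oW WU|x /UU]; [exact: h1|exact: h2| |exact: h4].
by apply: h3 => // x /WU /UU.
Qed.

Lemma smf_ext U F G : open U -> (forall x es, U x -> F x es = G x es) ->
  is_smf U F -> is_smf U G.
Proof.
move=> oU FG [h1 h2 h3 h4]; split=> [x Ux p a b q|x Ux p n c u v q|W oW WU es hes|x Ux].
- by rewrite -!FG // h1.
- by rewrite -!FG // h2.
- by apply: fs_ext (h3 W oW WU es hes) => // x /WU Ux; rewrite FG.
- have [W [N [oW Wx bW]]] := h4 x Ux; exists (W `&` U), N.
  split=> [|//|y [Wy Uy] es hes]; first exact: openI.
  by rewrite -FG //; apply: bW.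
Qed.

Lemma smf_local U F : (forall x, U x -> exists W, [/\ open W, W x & is_smf W F]) ->
  is_smf U F.
Proof.
move=> loc; split=> [x Ux|x Ux|W oW WU es hes|x Ux].
- by have [W [oW Wx [h _ _ _]]] := loc x Ux; apply: h.
- by have [W [oW Wx [_ h _ _]]] := loc x Ux; apply: h.
- apply: fs_glue => // x Wx; have [V [oV Vx [_ _ h _]]] := loc x (WU x Wx).
  exists (V `&` W); have oI : open (V `&` W) by exact: openI.
  split=> //.
  by apply: h => //; apply: all_hsec_restr hes => // y [].
- by have [W [oW Wx [_ _ _ h]]] := loc x Ux; apply: h.
Qed.

Lemma smf_linear U (c : K) F G : open U -> is_smf U F -> is_smf U G ->
  is_smf U (fun x es => c * F x es + G x es).
Proof.
move=> oU [f1 f2 f3 f4] [g1 g2 g3 g4].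
split=> [x Ux p a b q|x Ux p n d u v q|W oW WU es hes|x Ux].
- by rewrite f1 // g1 //; ring.
- by rewrite f2 // g2 //; ring.
- by apply: fs_linear => //; [exact: f3 | exact: g3].
have [W [N [oW Wx bW]]] := f4 x Ux; have [V [M [oV Vx bV]]] := g4 x Ux.
exists (W `&` V), (maxn N M); split=> [|//|y [Wy Vy] es]; first exact: openI.
by rewrite gtn_max => /andP[n1 n2]; rewrite bW // bV // mulr0 addr0.
Qed.

Lemma smf0 U : open U -> is_smf U (fun _ _ => 0).
Proof.
move=> oU; split=> [x _ p a b q|x _ p n c u v q|W oW _ es _|x Ux].
- by rewrite mulr0.
- by rewrite mulr0 addr0.
- exact: fs_cst.
- by exists U, 0%N.
Qed.

Lemma smf_sum (I : finType) U (F : I -> sform E) : open U ->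
  (forall i, is_smf U (F i)) -> is_smf U (fun x es => \sum_i F i x es).
Proof.
move=> oU sF; elim: (index_enum I) => [|i s IH].
  by apply: smf_ext (smf0 oU) => // x es _; rewrite big_nil.
apply: smf_ext (smf_linear 1 oU (sF i) IH) => // x es _.
by rewrite big_cons mul1r.
Qed.

Lemma smf_scale U f F : open U -> fs_O U f -> is_smf U F ->
  is_smf U (fun x es => f x * F x es).
Proof.
move=> oU fU [h1 h2 h3 h4].
split=> [x Ux p a b q|x Ux p n c u v q|W oW WU es hes|x Ux].
- by rewrite h1 //; ring.
- by rewrite h2 //; ring.
- by apply: fs_mul => //; [exact: fs_restr fU | exact: h3].
have [W [N [oW Wx bW]]] := h4 x Ux; exists W, N; split=> // y Wy es hes.
by rewrite bW // mulr0.
Qed.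

Definition twf (a : int) F : sform E := fun x => tw a (F x).

Lemma smf_tw U a F : open U -> is_smf U F -> is_smf U (twf a F).
Proof.
move=> oU [h1 h2 h3 h4].
split=> [x Ux|x Ux|W oW WU es hes|x Ux].
- exact/psym_tw/h1.
- exact/pmlin_tw/h2.
- rewrite /twf /tw; under [X in fs_O W X]funext do rewrite wdeg_pts.
  by apply: fs_scale => //; exact: h3.
have [W [N [oW Wx bW]]] := h4 x Ux; exists W, N; split=> // y Wy es hes.
by rewrite /twf /tw bW // mulr0.
Qed.

Definition cutdeg (d : int) F : sform E :=
  fun x es => if wdeg es == - d then F x es else 0.

Lemma cutdeg_deg U d F : form_deg U (cutdeg d F) d.
Proof.
by move=> x es _; rewrite /cutdeg; case: ifP => [/eqP //|_]; rewrite eqxx.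
Qed.

(** Degree and length of a word are unchanged when letters are permuted, when a vector is replaced
    within its slot and when the point moves along sections, so selecting words by them is harmless.
    This yields homogeneous components as well as components of fixed word length. *)
Lemma smf_cut_gen U (P : int -> nat -> bool) F : open U -> is_smf U F ->
  is_smf U (fun x es => if P (wdeg es) (size es) then F x es else 0).
Proof.
move=> oU [h1 h2 h3 h4].
split=> [x Ux p a b q|x Ux p n c u v q|W oW WU es hes|x Ux].
- rewrite h1 // !wdeg_cat !wdeg_cons (addrCA (tag a)) !size_cat /=.
  by case: ifP => // _; rewrite mulr0.
- rewrite h2 // !wdeg_cat !wdeg_cons !size_cat /=.
  by case: ifP => // _; rewrite mulr0 addr0.
- case Pe: (P (sdeg (degs es)) (size es)); last first.
    apply: fs_ext (fs_cst 0 oW) => // x _.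
    by rewrite wdeg_pts size_map Pe.
  apply: fs_ext (h3 W oW WU es hes) => // x _.
  by rewrite wdeg_pts size_map Pe.
have [W [N [oW Wx bW]]] := h4 x Ux; exists W, N; split=> // y Wy es hes.
by rewrite bW //; case: ifP.
Qed.

Lemma smf_cutdeg U d F : open U -> is_smf U F -> is_smf U (cutdeg d F).
Proof. by move=> oU sF; exact: (smf_cut_gen (fun w _ => w == - d)). Qed.

Lemma freg_pmul U F G : open U -> freg U F -> freg U G ->
  freg U (fun x => pmul (F x) (G x)).
Proof.
move=> oU fF fG es; elim: es F G fF fG => [|e es IH] F G fF fG.
  move=> _; apply: (fs_ext (f := fun x => F x [::] * G x [::])) => //.
    by move=> x _; rewrite pmul_nil.
  by apply: fs_mul => //; [exact: (fF [::] (all_hsec_nil _)) |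
    exact: (fG [::] (all_hsec_nil _))].
move=> /all_hsec_cons[he hes].
have fc H : freg U H -> freg U (fun x => contr (at_pt x e) (H x)).
  by move=> fH s hs; apply: (fH (e :: s)); apply/all_hsec_cons.
apply: (fs_ext (f := fun x =>
  pmul (contr (at_pt x e) (F x)) (tw (tag e) (G x)) (pts x es) +
  pmul (F x) (contr (at_pt x e) (G x)) (pts x es))) => //.
  by move=> x _; rewrite /= pmul_cons.
apply: fs_add => //; last by apply: IH => //; exact: fc.
apply: (IH (fun x => contr (at_pt x e) (F x)) (fun x => tw (tag e) (G x))) => //.
  exact: fc.
move=> s hs; rewrite /tw; under [X in fs_O U X]funext do rewrite wdeg_pts.
by apply: fs_scale => //; exact: fG.
Qed.

Lemma smf_mul U F G : open U -> is_smf U F -> is_smf U G -> is_smf U (fmul F G).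
Proof.
move=> oU [f1 f2 f3 f4] [g1 g2 g3 g4].
split=> [x Ux|x Ux|W oW WU|x Ux].
- exact: psym_pmul (f1 x Ux) (g1 x Ux).
- exact: pmlin_pmul (f2 x Ux) (g2 x Ux).
- exact: freg_pmul (f3 W oW WU) (g3 W oW WU).
have [W [N [oW Wx bW]]] := f4 x Ux; have [V [M [oV Vx bV]]] := g4 x Ux.
exists (W `&` V), (N + M)%N; split=> [|//|y [Wy Vy] es hes]; first exact: openI.
apply: big1 => m _.
(* In a word of more than [N + M] letters, one of the two subwords exceeds its own bound. *)
have [n1|n1] := ltnP N (size (mask m es)).
  by rewrite [F _ _]bW // mulr0 mul0r.
rewrite [G _ _]bV ?mulr0 //.
have : (size (mask m es) + size (cmask m es))%N = size es.
  by rewrite /cmask !size_mask ?size_map ?size_tuple // count_map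
    -[RHS](size_tuple m) -(count_predC id m).
have ar (a b c : nat) : (a + b)%N = c -> (N + M < c)%N -> (a <= N)%N -> (M < b)%N.
  by lia.
by move=> e; exact: ar e hes n1.
Qed.

Lemma smf_of_fun U f : open U -> fs_O U f -> is_smf U (of_fun E f).
Proof.
move=> oU fU; split=> [x Ux p a b q|x Ux p n c u v q|W oW WU [|e es] hes|x Ux].
- by case: p => [|? ?]; rewrite mulr0.
- by case: p => [|? ?]; rewrite mulr0 addr0.
- exact: fs_restr fU.
- exact: fs_cst.
- by exists U, 0%N; split=> // y _ [].
Qed.

Lemma smf_of_dual U (a : dsection E) : open U -> is_dual U a -> is_smf U (of_dual a).
Proof.
move=> oU [la ra].
split=> [x Ux p u v q|x Ux p n c u v q|W oW WU [|e [|e' es]] hes|x Ux].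
- by case: p => [|h [|h' p]]; rewrite /= mulr0.
- case: p => [|h [|h' p]]; rewrite /= ?mulr0 ?addr0 //.
  by case: q => [|h q]; rewrite ?mulr0 ?addr0 // la.
- exact: fs_cst.
- by apply: ra => //; have /all_hsec_cons[] := hes.
- exact: fs_cst.
- by exists U, 1%N; split=> // y _ [|e [|e' es]].
Qed.

Lemma smf_sym_prod U (al : seq (dsection E)) : open U ->
  (forall i, (i < size al)%N -> is_dual U (nth (fun _ _ => 0) al i)) ->
  is_smf U (sym_prod al).
Proof.
move=> oU; elim: al => [|a al IH] h; first by apply: smf_of_fun => //; exact: fs_cst.
apply: smf_mul => //; first by apply: smf_of_dual => //; exact: (h 0%N).
by apply: IH => i hi; exact: (h i.+1).
Qed.

Lemma smf_of_form U F : is_form U F -> is_smf U F.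
Proof.
move=> fF; apply: smf_local => x Ux.
have [W [oW Wx WU [N [f [al [fO ha FE]]]]]] := fF x Ux.
exists W; split=> //.
apply: (smf_ext (F := fun y es => \sum_j f j y * sym_prod (al j) y es)) => //.
  by move=> y es Wy; rewrite FE.
apply: smf_sum => // j; apply: smf_scale => //; apply: smf_sym_prod => // i.
exact: ha.
Qed.

Lemma form_local U F :
  (forall x, U x -> exists W, [/\ open W, W x, W `<=` U & is_form W F]) -> is_form U F.
Proof.
move=> loc x Ux; have [W [oW Wx WU fW]] := loc x Ux.
have [V [oV Vx VW hV]] := fW x Wx; exists V; split=> // y /VW; exact: WU.
Qed.

Lemma form_ext U F G : (forall x es, U x -> F x es = G x es) ->
  is_form U F -> is_form U G.
Proof.
move=> FG fF x Ux; have [W [oW Wx WU [N [f [al [fO ha FE]]]]]] := fF x Ux.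
exists W; split=> //; exists N, f, al; split=> // y es Wy.
by rewrite -FG ?FE //; exact: WU.
Qed.

Lemma form_add U F G : open U -> is_form U F -> is_form U G ->
  is_form U (fun x es => F x es + G x es).
Proof.
move=> oU fF fG x Ux.
have [W [oW Wx WU [N [f [al [fO ha FE]]]]]] := fF x Ux.
have [V [oV Vx VU [M [g [be [gO hb GE]]]]]] := fG x Ux.
have oI : open (W `&` V) by exact: openI.
exists (W `&` V); split=> // [y [/WU]//|]; exists (N + M)%N.
exists (fun k : 'I_(N + M) => match fintype.split k with inl i => f i | inr j => g j end).
exists (fun k : 'I_(N + M) => match fintype.split k with inl i => al i | inr j => be j end).
split=> [k|k i|y es [Wy Vy]].
- by case: (fintype.split k) => j; [apply: (fs_restr _ oI _ (fO j)) | apply: (fs_restr _ oI _ (gO j))] => // y [].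
- by case: (fintype.split k) => j hi; [apply: (dual_restr _ (ha j i hi)) | apply: (dual_restr _ (hb j i hi))] => y [].
- rewrite FE // GE // big_split_ord /=; congr (_ + _); apply: eq_bigr => j _.
    by rewrite (unsplitK (inl j)).
  by rewrite (unsplitK (inr j)).
Qed.

Lemma form0 U : open U -> is_form U ((fun _ _ => 0) : sform E).
Proof.
move=> oU x Ux; exists U; split=> //; exists 0%N, (fun _ _ => 0), (fun=> [::]).
by split=> [[]//|[]//|y es _]; rewrite big_ord0.
Qed.

Lemma form_sum (I : finType) U (F : I -> sform E) : open U ->
  (forall i, is_form U (F i)) -> is_form U (fun x es => \sum_i F i x es).
Proof.
move=> oU sF; elim: (index_enum I) => [|i s IH].
  by apply: form_ext (form0 oU) => x es _; rewrite big_nil.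
apply: form_ext (form_add oU (sF i) IH) => x es _.
by rewrite big_cons.
Qed.

Lemma form_dual_mul U (a : dsection E) G : is_dual U a -> is_form U G ->
  is_form U (fmul (of_dual a) G).
Proof.
move=> da fG x Ux; have [V [oV Vx VU [M [g [be [gO hb GE]]]]]] := fG x Ux.
exists V; split=> //; exists M, g, (fun j => a :: be j); split=> //.
  by move=> j [_|i] //=; [exact: dual_restr da | exact: hb].
move=> y es Vy; rewrite fmulE (eq_pmul (frefl _) (GE y ^~ Vy)) pmul_sumr; apply: eq_bigr => j _.
exact: pmulZr.
Qed.

Lemma form_scale U (c : K) F : is_form U F -> is_form U (fun x es => c * F x es).
Proof.
move=> fF x Ux; have [V [oV Vx VU [M [g [be [gO hb GE]]]]]] := fF x Ux.
exists V; split=> //; exists M, (fun j y => c * g j y), be; split=> //.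
  by move=> j; exact: fs_scale.
move=> y es Vy; rewrite GE // mulr_sumr; apply: eq_bigr => j _.
by rewrite mulrA.
Qed.

Lemma form_of_fun U f : open U -> fs_O U f -> is_form U (of_fun E f).
Proof.
move=> oU fU x Ux; exists U; split=> //.
exists 1%N, (fun _ => f), (fun=> [::]); split=> // y es Uy.
by rewrite big_ord1 /= /of_fun; case: es => [|? ?]; rewrite ?mulr1 ?mulr0.
Qed.

(** Either the first letter [e] is paired with [gf_dual i], and summing over [i] gives back
    [H (e :: es)] by the resolution of the identity; or it stays in [H], where the twist absorbs the
    sign of exchanging it with [gf_sec i] and the formula for [contr e H] remains. *)
Lemma euler_formula W (Fr : gframe E) x (H : seq (hvec E x) -> K) es :
  is_gframe W Fr -> W x -> psym H -> pmlin H ->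
  \sum_i pmul (of_dual (@gf_dual _ _ _ Fr i) x)
     (tw (tag (gf_sec i)) (contr (at_pt x (gf_sec i)) H)) es =
  (size es)%:R * H es.
Proof.
move=> fF Wx; elim: es H => [|e es IH] H sH lH.
  by rewrite mul0r big1 // => i _; rewrite pmul_nil mul0r.
under eq_bigr do rewrite pmul_letter.
rewrite big_split /= -[(size es).+1%:R]natr1 mulrDl mul1r addrC; congr (_ + _).
  rewrite -/(contr e H es) -IH; [|exact: psym_contr|exact: pmlin_contr].
  apply: eq_bigr => i _; apply: eq_pmul => // s.
  rewrite /contr /tw wdeg_cons (sH [::]) /= ksDl -/(at_pt x _).
  by rewrite (ksC _ (tag e)) mulrCA !mulrA (ksC _ (tag (at_pt x (gf_sec i))))
    ks_sq mul1r.
rewrite (@gframe_expand _ _ _ W Fr x (fun h => H (h :: es)) e fF Wx); last first.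
  by move=> n c u v; apply: (lH [::]).
apply: eq_bigr => i _; have [->|/(gf_deg fF Wx)] := eqVneq (gf_dual i e) 0.
  by rewrite !mul0r.
by rewrite opprK => ->; rewrite tw_sq.
Qed.

Hypothesis char0 : [pchar K] =i pred0.

Lemma form_of_smf U F : open U -> is_smf U F -> is_form U F.
Proof.
move=> oU sF; apply: form_local => x Ux.
have [W' [N [oW' W'x bF]]] := smf_bound sF Ux.
pose W := fr_dom E x `&` (U `&` W').
have oW : open W by apply: openI; [exact: fr_open | exact: openI].
have fW : is_gframe W (fr E x).
  by apply: is_gframe_restr (fr_ok E x) => //; [exact: fr_open | move=> y []].
have WU : W `<=` U by move=> y [_ []].
exists W; split=> //; first by split=> //; exact: fr_mem.
(* Induction on the word length [k] of a form concentrated in that length: contraction with a frame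
   section lowers it by one, and the factor [k.+1] is invertible in characteristic 0. *)
have H k G : is_smf W G -> (forall y es, W y -> G y es != 0 -> size es = k) ->
    is_form W G.
  elim: k G => [|k IH] G sG hG.
    apply: (form_ext (F := of_fun E (fun y => G y [::]))) => [y [|e es] Wy //|].
      by apply/eqP; rewrite /= eq_sym; apply/contraT => /(hG _ _ Wy).
    apply: form_of_fun => //.
    exact: (smf_reg sG oW (@subset_refl _ _) (all_hsec_nil _)).
  apply: (form_ext (F := fun y es => k.+1%:R^-1 * \sum_i
    fmul (of_dual (@gf_dual _ _ _ (fr E x) i)) (fun z => tw (tag (gf_sec i))
      (contr (at_pt z (gf_sec i)) (G z))) y es)).
    move=> y es Wy; rewrite (euler_formula es fW Wy (smf_sym sG Wy) (smf_lin sG Wy)).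
    have [->|nz] := eqVneq (G y es) 0; first by rewrite !mulr0.
    rewrite (hG y es Wy nz) mulKf //.
    by move/pcharf0P : char0 => ->.
  apply: form_scale; apply: form_sum => // i.
  apply: form_dual_mul; first exact: (gf_dual_ok fW i).
  apply: IH => [|y es Wy].
    apply: (@smf_tw _ _ (fun z => contr (at_pt z (gf_sec i)) (G z))) => //.
    have bs := gf_sec_ok fW i.
    split=> [y Wy|y Wy|V oV VW es hes|y Wy].
    - exact/psym_contr/(smf_sym sG Wy).
    - exact/pmlin_contr/(smf_lin sG Wy).
    - apply: (smf_reg sG oV VW (es := gf_sec i :: es)); apply/all_hsec_cons.
      by split=> //; exact: hsec_restr bs.
    - have [V [M [oV Vy hV]]] := smf_bound sG Wy; exists V, M; split=> // z Vz es hes.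
      by rewrite /contr hV //=; lia.
  rewrite /tw /contr mulf_eq0 negb_or => /andP[_ /(hG _ _ Wy)].
  by case.
(* Over [W] words of more than [N] letters give 0, so these components add up to [F]. *)
pose Fk (k : 'I_N.+1) : sform E := fun y es => if size es == k then F y es else 0.
apply: (form_ext (F := fun y es => \sum_k Fk k y es)).
  move=> y es [_ [Uy W'y]]; have [szN|szN] := ltnP N (size es).
    rewrite big1 ?bF // => k _; rewrite /Fk; case: eqP => // ek.
    by rewrite bF.
  rewrite (bigD1 (inord (size es))) //= /Fk inordK // eqxx big1 ?addr0 // => k nk.
  case: eqP => // ek; case/eqP: nk; apply: val_inj; rewrite /= inordK // ek //.
apply: form_sum => // k; apply: (H k).
  apply: (@smf_cut_gen W (fun _ n => n == k)) => //; exact: smf_restr sF.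
by move=> y es Wy; rewrite /Fk; case: ifP => [/eqP //|_]; rewrite eqxx.
Qed.

End Forms.

Arguments twf {K X E} a F x es.
Arguments cutdeg {K X E} d F x es.

(** * Forms with values in the dual of V *)

Section VForms.
Variables (K : fieldType) (X : fspace K) (E V : gbundle X).
Hypothesis char0 : [pchar K] =i pred0.
Implicit Types (U W : set X) (x : X) (F G : sform E) (f : X -> K).
Implicit Types (w : vform E V) (e : hsec V).
Local Notation ks := (@ksign K).

Lemma form_restr U U' F : open U' -> U' `<=` U -> is_form U F -> is_form U' F.
Proof.
by move=> oU' UU /smf_of_form/(smf_restr UU); apply: form_of_smf.
Qed.

Lemma form_linear U c F G : open U -> is_form U F -> is_form U G ->
  is_form U (fun x es => c * F x es + G x es).
Proof.
move=> oU /smf_of_form sF /smf_of_form sG; apply: form_of_smf => //.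
exact: smf_linear.
Qed.

Lemma form_mul U F G : open U -> is_form U F -> is_form U G -> is_form U (fmul F G).
Proof.
move=> oU /smf_of_form sF /smf_of_form sG; apply: form_of_smf => //.
exact: smf_mul.
Qed.

Lemma form_tw U a F : open U -> is_form U F -> is_form U (twf a F).
Proof. by move=> oU /smf_of_form sF; apply/form_of_smf/smf_tw. Qed.

Lemma form_fscale U f F : open U -> fs_O U f -> is_form U F ->
  is_form U (fun x es => f x * F x es).
Proof. by move=> oU fU /smf_of_form sF; apply/form_of_smf/smf_scale. Qed.

Lemma form_cutdeg U d F : open U -> is_form U F -> is_form U (cutdeg d F).
Proof. by move=> oU /smf_of_form sF; apply/form_of_smf/smf_cutdeg. Qed.

Lemma form_reg U U' F es : open U' -> U' `<=` U -> is_form U F -> all_hsec U' es ->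
  fs_O U' (fun x => F x (pts x es)).
Proof. by move=> oU' UU /smf_of_form sF; apply: (smf_reg sF). Qed.

Definition vat e w : sform E := fun x es => w x es (at_pt x e).

(** A multilinear description of [is_vform], which delegates all but the slot of V to forms on E;
    the two agree by means of a local frame of V. *)
Record is_smvf U w : Prop := {
  svf_lin : forall x es, U x -> hlin (w x es);
  svf_form : forall U' e, open U' -> U' `<=` U -> is_hsec U' e ->
    is_form U' (vat e w) }.

Lemma smvf_of_vform U w : is_vform U w -> is_smvf U w.
Proof.
move=> vw; split=> [x es Ux|U' e oU' UU he].
  have [W [oW Wx WU [N [xi [b [hxi hb wE]]]]]] := vw x Ux.
  move=> n c u v; rewrite !wE // mulr_sumr -big_split; apply: eq_bigr => j _ /=.
  by rewrite /ftens (dual_hlin (hb j) Wx) /=; ring.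
apply: form_local => x U'x.
have [W [oW Wx WU [N [xi [b [hxi hb wE]]]]]] := vw x (UU x U'x).
have oI : open (W `&` U') by exact: openI.
exists (W `&` U'); split=> //.
apply: (form_ext (F := fun y es =>
    \sum_j dual_app (b j) e y * twf (tag e) (xi j) y es)).
  move=> y es [Wy U'y]; rewrite /vat wE //; apply: eq_bigr => j _.
  by rewrite /ftens /twf /tw /dual_app -/(wdeg es); ring.
apply: form_sum => // j; apply: form_fscale => //.
  apply: (dual_app_regular oI _ (hb j)); first by move=> y [].
  by apply: hsec_restr he => // y [].
by apply: form_tw => //; apply: form_restr (hxi j) => // y [].
Qed.

(** Locally [w] is the sum of the contractions of [w] with the frame sections of V, tensored with
    the dual sections; the twist of the contractions undoes the sign built into [ftens]. *)
Lemma vform_of_smvf U w : open U -> is_smvf U w -> is_vform U w.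
Proof.
move=> oU sw x Ux; pose W := fr_dom V x `&` U.
have oW : open W by apply: openI => //; exact: fr_open.
have fW : is_gframe W (fr V x).
  by apply: is_gframe_restr (fr_ok V x) => //; [exact: fr_open | move=> y []].
have WU : W `<=` U by move=> y [].
exists W; split=> //; first by split=> //; exact: fr_mem.
exists #|gf_idx (fr V x)|.
pose ev (i : 'I_#|gf_idx (fr V x)|) : gf_idx (fr V x) := enum_val i.
exists (fun i => twf (tag (gf_sec (ev i))) (vat (gf_sec (ev i)) w)).
exists (fun i => @gf_dual _ _ _ (fr V x) (ev i)).
split=> [i|i|y es v Wy].
- apply: form_tw => //; apply: (svf_form sw) => //; exact: (gf_sec_ok fW).
- exact: (gf_dual_ok fW).
rewrite -(big_enum_val (A := gf_idx (fr V x)) (fun i => ftens (twf (tag (gf_sec i))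
  (vat (gf_sec i) w)) (@gf_dual _ _ _ (fr V x) i) y es v)).
rewrite (gframe_expand v fW Wy (svf_lin sw es (WU y Wy))).
apply: eq_bigr => i _; rewrite /ftens /twf /tw -/(wdeg es) /vat.
have [->|/(gf_deg fW Wy)] := eqVneq (gf_dual i v) 0; first by rewrite mul0r mulr0.
by rewrite opprK => ->; rewrite mulrA ks_sq mul1r mulrC.
Qed.

Lemma vform_form U U' w e : open U' -> U' `<=` U -> is_hsec U' e -> is_vform U w ->
  is_form U' (vat e w).
Proof. by move=> oU' UU he /smvf_of_vform sw; apply: (svf_form sw). Qed.

Lemma vform_hlin U w x es : is_vform U w -> U x -> hlin (w x es).
Proof. by move=> /smvf_of_vform sw; apply: svf_lin. Qed.

Lemma vform_word U w x v : open U -> is_vform U w -> U x ->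
  psym (fun es => w x es v) /\ pmlin (fun es => w x es v).
Proof.
move=> oU vw Ux; pose W := fr_dom V x `&` U.
have oW : open W by apply: openI => //; exact: fr_open.
have h : is_smf W (vat (extend v) w).
  apply: smf_of_form; apply: (@vform_form U) => //; first by move=> y [].
  by apply: hsec_restr (extend_hsec v) => //; [exact: fr_open | move=> y []].
have Wx : W x by split=> //; exact: fr_mem.
have := conj (smf_sym h Wx) (smf_lin h Wx).
by rewrite /vat at_pt_extend.
Qed.

Lemma vform_reg U U' w es e : open U' -> U' `<=` U -> is_vform U w ->
  all_hsec U' es -> is_hsec U' e -> fs_O U' (fun x => w x (pts x es) (at_pt x e)).
Proof.
move=> oU' UU vw hes he.
exact: form_reg oU' (@subset_refl _ _) (vform_form oU' UU he vw) hes.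
Qed.

Lemma vform_ext U w w' : (forall x es v, U x -> w x es v = w' x es v) ->
  is_vform U w -> is_vform U w'.
Proof.
move=> ww' vw x Ux; have [W [oW Wx WU [N [xi [b [hxi hb wE]]]]]] := vw x Ux.
exists W; split=> //; exists N, xi, b; split=> // y es v Wy.
by rewrite -ww' ?wE //; exact: WU.
Qed.

Lemma vform_restr U U' w : open U' -> U' `<=` U -> is_vform U w -> is_vform U' w.
Proof.
move=> oU' UU /smvf_of_vform[h1 h2]; apply: vform_of_smvf => //.
split=> [x es /UU|W e oW WU]; first exact: h1.
by apply: h2 => // y /WU/UU.
Qed.

Lemma vform_linear U c w w' : open U -> is_vform U w -> is_vform U w' ->
  is_vform U (fun x es v => c * w x es v + w' x es v).
Proof.
move=> oU /smvf_of_vform[h1 h2] /smvf_of_vform[h3 h4].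
apply: vform_of_smvf => //; split=> [x es Ux|W e oW WU he].
  by move=> n d u v; rewrite h1 // h3 //; ring.
by apply: form_linear => //; [exact: h2 | exact: h4].
Qed.

Lemma vform0 U : open U -> is_vform U ((fun _ _ _ => 0) : vform E V).
Proof.
move=> oU; apply: vform_of_smvf => //; split=> [x es Ux n c u v|W e oW WU he].
  by rewrite mulr0 addr0.
exact: form0.
Qed.

(** The part of the sign that involves [v] is a twist of [F]; the module structure thereby inherits
    the algebra of [pmul]. *)
Lemma fscaleE F w x es v :
  fscale F w x es v = pmul (tw (tag v) (F x)) (fun s => w x s v) es.
Proof.
by apply: eq_bigr => m _; rewrite /tw ksDr -!/(wdeg _); ring.
Qed.

Lemma vform_fscale U F w : open U -> is_form U F -> is_vform U w ->
  is_vform U (fscale F w).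
Proof.
move=> oU fF /smvf_of_vform[h1 h2]; apply: vform_of_smvf => //.
split=> [x es Ux|W e oW WU he].
  move=> n c u v; rewrite !fscaleE /= -pmul_linr; apply: eq_pmul => // s.
  exact: h1.
apply: (form_ext (F := fmul (twf (tag e) F) (vat e w))).
  by move=> x es _; rewrite /vat fscaleE.
apply: form_mul => //; first by apply: form_tw => //; exact: form_restr fF.
exact: h2.
Qed.

Lemma of_vdualE (a : dsection V) x es v :
  of_vdual E a x es v = if es is [::] then a x v else 0.
Proof.
rewrite /of_vdual /ftens /of_fun; case: es => [|? ?]; last by rewrite mulr0 mul0r.
by rewrite -/(wdeg _) wdeg_nil ks0l !mul1r.
Qed.

Lemma vat_of_vdual (a : dsection V) e : vat e (of_vdual E a) = of_fun E (dual_app a e).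
Proof.
apply: functional_extensionality_dep => x; apply: funext => es.
by rewrite /vat of_vdualE.
Qed.

Lemma vform_of_vdual U (a : dsection V) : open U -> is_dual U a ->
  is_vform U (of_vdual E a).
Proof.
move=> oU da; apply: vform_of_smvf => //; split=> [x es Ux n c u v|W e oW WU he].
  rewrite !of_vdualE; case: es => [|? ?]; last by rewrite mulr0 addr0.
  exact: dual_hlin da Ux _ _ _ _.
rewrite vat_of_vdual; apply: form_of_fun => //; exact: dual_app_regular da he.
Qed.

Lemma of_vdual_deg U (a : dsection V) d : dual_deg U a d ->
  vform_deg U (of_vdual E a) d.
Proof.
move=> da x es v Ux; rewrite of_vdualE; case: es => [|? ?]; last by rewrite eqxx.
by move=> /(da x v Ux) ->; rewrite /sdeg big_nil add0r.
Qed.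

Lemma fscale_fun f w x es v : fscale (of_fun E f) w x es v = f x * w x es v.
Proof.
rewrite fscaleE -(pmul_fun (f x) (w x ^~ v) es); apply: eq_pmul => // -[|? ?] //=.
  by rewrite /tw wdeg_nil ks0l mul1r.
by rewrite /tw mulr0.
Qed.

Lemma fscale_of_vdual F (a : dsection V) x es v :
  fscale F (of_vdual E a) x es v = ks (wdeg es) (tag v) * F x es * a x v.
Proof.
rewrite /of_vdual fscale_ftens /ftens -/(wdeg es); congr (_ * _ * _).
rewrite fmulE; have d1 : pdeg (@punit K X E x) 0.
  by case=> [|? ?]; rewrite ?eqxx // wdeg_nil oppr0.
rewrite -[RHS]pmul1l (pmulC _ d1).
by apply: eq_pmul => // s; rewrite /tw ks0 mul1r.
Qed.

(** * Word length against degree for a negatively graded E *)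

Section Negative.
Hypothesis negE : forall (n : int) x, 0 <= n -> \dim {:E n x} = 0%N.

(** By multilinearity a nonzero value forces all letters to be nonzero, and then their degrees lie
    between [-N] and [-1]. *)
Lemma wdeg_bound : exists N : nat, forall x (H : seq (hvec E x) -> K) es, pmlin H ->
  H es != 0 -> (Posz (size es) <= - wdeg es) /\ (- wdeg es <= (N * size es)%N%:Z).
Proof.
have [N hN] := gb_vanish E; exists N => x H es; elim: es H => [|[n u] es IH] H lH nz.
  by rewrite wdeg_nil oppr0 muln0.
have nu : u != 0.
  by apply: contraNneq nz => u0; rewrite u0; apply/eqP; exact: (pmlin0 [::] n es lH).
have n0 : n < 0.
  rewrite ltNge; apply: contraNN nu => /(negE x)/eqP; rewrite dimv_eq0 => /eqP e.
  by rewrite -memv0 -e memvf.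
have nN : (`|n|%N <= N)%N by rewrite leqNgt; apply: contraNN nu => /(hN n x u) ->.
have [h1 h2] := IH _ (pmlin_contr (Hvec u) lH) nz.
rewrite wdeg_cons -[size (_ :: es)]/(size es).+1 mulnS -[tag _]/n; move: h1 h2 n0 nN.
by move: (wdeg es) (size es) => a b h1 h2 n0 nN; split; lia.
Qed.

(** Near [x] only words of at most [B] letters matter, each letter contributing at most [N] to the
    degree, so the degrees of the components run from 0 to [N * B]. This is what gives access to a
    Leibniz rule stated for homogeneous forms. *)
Lemma form_homogeneous U F x : open U -> is_form U F -> U x ->
  exists W (N : nat), [/\ open W, W x, W `<=` U & forall y es, W y ->
    F y es = \sum_(d < N) cutdeg (Posz d) F y es].
Proof.
move=> oU /smf_of_form sF Ux; have [W [B [oW Wx bW]]] := smf_bound sF Ux.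
have [N hN] := wdeg_bound; exists (W `&` U), (N * B).+1.
split=> //; first exact: openI.
move=> y es [Wy Uy]; have [F0|nz] := eqVneq (F y es) 0.
  by rewrite F0 big1 // => d _; rewrite /cutdeg F0 if_same.
have [h1 h2] := hN y _ es (smf_lin sF Uy) nz.
have szB : (size es <= B)%N by rewrite leqNgt; apply: contraNN nz => /(bW y Wy) ->.
have hd : (absz (wdeg es) < (N * B).+1)%N by rewrite ltnS (@leq_trans (N * size es)) ?leq_mul //; lia.
rewrite (bigD1 (Ordinal hd)) //= /cutdeg big1 ?addr0.
  by rewrite ifT //; apply/eqP; lia.
move=> d; case: ifP => // /eqP e /eqP nd; case: nd; apply: val_inj => /=.
by rewrite e; lia.
Qed.

(* All letters have negative degree, so homogeneity bounds the word length. *)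
Lemma smf_of_homogeneous U F d : open U ->
  (forall x, U x -> psym (F x)) -> (forall x, U x -> pmlin (F x)) ->
  (forall U', open U' -> U' `<=` U -> freg U' F) -> form_deg U F d -> is_smf U F.
Proof.
move=> oU h1 h2 h3 dF; split=> // x Ux; exists U, `|d|%N; split=> // y Uy es hes.
apply: contraTeq hes => nz; have [N hN] := wdeg_bound.
have [] := hN y _ es (h2 y Uy) nz.
by rewrite /wdeg (dF y es Uy nz) opprK -leqNgt; lia.
Qed.
End Negative.
End VForms.

Arguments vat {K X E V} e w x es.

(** * The anchor and Q on functions *)

Section AnchorAndQ.
Variables (K : fieldType) (X : fspace K) (E : gbundle X) (L : lie_infty_algebroid E).
Implicit Types (U W : set X) (x : X) (f g : X -> K).
Local Notation rho := (li_rho L).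

Lemma rho_ext_size x (es : seq (hvec E x)) f : size es <> 1%N -> rho_ext rho es f = 0.
Proof. by case: es => [|e [|e' es]]. Qed.

Lemma rho_ext_deg x (es : seq (hvec E x)) f : rho_ext rho es f != 0 -> wdeg es = - 1.
Proof.
case: es => [|e [|e' es]]; rewrite /= ?eqxx // => h.
rewrite wdeg_cons wdeg_nil addr0; apply: contraNeq h => h.
by rewrite (@untag_dflt _ (fun n => E n x)).
Qed.

Lemma rho_ext_cases x (es : seq (hvec E x)) :
  (forall f, rho_ext rho es f = 0) \/
  exists u, forall f, rho_ext rho es f = @li_rho _ _ _ L x u f.
Proof.
case: es => [|[n u] [|e' es]]; [by left| |by left].
have [e|ne] := eqVneq n (-1); last by left=> f; rewrite /= (@untag_dflt _ (fun n => E n x)).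
by subst n; right; exists u => f; rewrite /rho_ext -/(Hvec u) untag_Hvec.
Qed.

Lemma rho_extM U x (es : seq (hvec E x)) f g : open U -> U x -> fs_O U f -> fs_O U g ->
  rho_ext rho es (fun y => f y * g y) = rho_ext rho es f * g x + f x * rho_ext rho es g.
Proof.
move=> oU Ux fU gU; have [h|[u h]] := rho_ext_cases es; rewrite !h.
  by rewrite mul0r mulr0 addr0.
by have [hM _ _] := anchor_tangent (li_anchor (li_laws L)) u oU Ux; apply: hM.
Qed.

Lemma rho_ext_lin U x (es : seq (hvec E x)) c f g : open U -> U x ->
  fs_O U f -> fs_O U g ->
  rho_ext rho es (fun y => c * f y + g y) = c * rho_ext rho es f + rho_ext rho es g.
Proof.
move=> oU Ux fU gU; have [h|[u h]] := rho_ext_cases es; rewrite !h.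
  by rewrite mulr0 addr0.
by have [_ hL _] := anchor_tangent (li_anchor (li_laws L)) u oU Ux; apply: hL.
Qed.

Lemma rho_ext_local U x (es : seq (hvec E x)) f g : open U -> U x ->
  fs_O U f -> (forall y, U y -> f y = g y) -> rho_ext rho es f = rho_ext rho es g.
Proof.
move=> oU Ux fU fg; have [h|[u h]] := rho_ext_cases es; rewrite !h //.
have [_ _ hE] := anchor_tangent (li_anchor (li_laws L)) u oU Ux; apply: hE => //.
exact: fs_ext fU.
Qed.

Lemma rho_ext0 x (es : seq (hvec E x)) : rho_ext rho es (fun=> 0) = 0.
Proof.
have h := @rho_ext_lin setT x es 1 (fun=> 0) (fun=> 0) openT I
  (fs_cst 0 openT) (fs_cst 0 openT).
apply: (addIr (rho_ext rho es (fun=> 0))); rewrite add0r -{1}[rho_ext _ _ _]mul1r -h.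
by congr rho_ext; apply: funext => y; rewrite mulr0 addr0.
Qed.

Lemma rho_ext_sum (I : finType) U x (es : seq (hvec E x)) (f g : I -> X -> K) :
  open U -> U x -> (forall i, fs_O U (f i)) -> (forall i, fs_O U (g i)) ->
  rho_ext rho es (fun y => \sum_i f i y * g i y) =
  \sum_i (rho_ext rho es (f i) * g i x + f i x * rho_ext rho es (g i)).
Proof.
move=> oU Ux fU gU; elim: (index_enum I) => [|i s IH].
  rewrite big_nil -[RHS](rho_ext0 es); apply: (rho_ext_local es oU Ux).
    by apply: fs_ext (fs_cst 0 oU) => // y _; rewrite big_nil.
  by move=> y _; rewrite big_nil.
have hs r : fs_O U (fun y => \sum_(i <- r) f i y * g i y).
  elim: r => [|j r IHr]; first by apply: fs_ext (fs_cst 0 oU) => // y _; rewrite big_nil.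
  apply: fs_ext (fs_add oU (fs_mul oU (fU j) (gU j)) IHr) => // y _.
  by rewrite big_cons.
rewrite big_cons -IH -(rho_extM es oU Ux (fU i) (gU i)).
rewrite -[X in X + _]mul1r -(rho_ext_lin es 1 oU Ux (fs_mul oU (fU i) (gU i)) (hs s)).
by apply: (rho_ext_local es oU Ux (hs _)) => y _; rewrite big_cons mul1r.
Qed.

Lemma rho_ext_pmlin U x f : open U -> U x -> fs_O U f ->
  pmlin (fun es : seq (hvec E x) => rho_ext rho es f).
Proof.
move=> oU Ux fU [|h [|h' p]] n c u v q /=; rewrite ?mulr0 ?addr0 //.
case: q => [|h q]; last by rewrite mulr0 addr0.
have [e|ne] := eqVneq n (-1); last first.
  by rewrite !(@untag_dflt _ (fun n => E n x)) // mulr0 addr0.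
subst n; rewrite !untag_Hvec.
exact: (anchor_linear (li_anchor (li_laws L)) c u v oU Ux fU).
Qed.

Lemma rho_ext_regular U f es : open U -> fs_O U f -> all_hsec U es ->
  fs_O U (fun x => rho_ext rho (pts x es) f).
Proof.
move=> oU fU; case: es => [|[n s] [|e' es]] hes; try exact: fs_cst.
have [hs _] := (all_hsec_cons _ _ _).1 hes.
have [e|ne] := eqVneq n (-1); last first.
  apply: fs_ext (fs_cst 0 oU) => // x _ /=.
  by rewrite (@untag_dflt _ (fun n => E n x)).
subst n; apply: fs_ext (anchor_regular (li_anchor (li_laws L)) oU hs fU) => // x _ /=.
by rewrite -/(Hvec (s x)) untag_Hvec.
Qed.

Hypothesis char0 : [pchar K] =i pred0.
Variables (Q : set X -> sform E -> sform E).
Arguments Q : clear implicits.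
Hypothesis HQ : is_homological L Q.

Lemma Q_ext U F G : open U -> is_form U F -> (forall x es, U x -> F x es = G x es) ->
  forall x es, U x -> Q U F x es = Q U G x es.
Proof.
move=> oU fF FG; apply: (hQ_local HQ oU oU (@subset_refl _ _) fF) => //.
exact: form_ext fF.
Qed.

(** The defining formula [hQ_fun] only covers one-letter words. As [Q f] has degree 1 and nonzero
    letters have degree at most [-1], longer words and the empty word have the wrong degree. *)
Lemma Q_of_fun U f x es : open U -> fs_O U f -> U x ->
  Q U (of_fun E f) x es = - rho_ext rho es f.
Proof.
move=> oU fU Ux; have ff := form_of_fun E oU fU.
have d0 : form_deg U (of_fun E f) 0.
  by move=> y [|h s] _ /=; rewrite ?eqxx // /sdeg big_nil oppr0.
have d1 := hQ_degree HQ oU ff d0; rewrite add0r in d1.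
have sQ := smf_of_form (hQ_section HQ oU ff).
have [sz|/eqP sz] := eqVneq (size es) 1%N; last first.
  rewrite rho_ext_size // oppr0; apply: contra_notP sz => /eqP nz.
  have [N hN] := wdeg_bound (li_negative (li_laws L)).
  have [h _] := hN _ _ _ (smf_lin sQ Ux) nz.
  have := d1 _ _ Ux nz; rewrite -/(wdeg es) => we; rewrite we in h.
  case: es we h {nz} => [|e [|? ?]] //=.
  by rewrite wdeg_nil.
case: es sz => [//|h [|//]] _; pose W := fr_dom E x `&` U.
have oW : open W by apply: openI => //; exact: fr_open.
have WU : W `<=` U by move=> y [].
have Wx : W x by split=> //; exact: fr_mem.
have fW : fs_O W f by exact: fs_restr fU.
rewrite (hQ_local HQ oU oW WU ff (form_of_fun E oW fW)) //.
rewrite -{1 2}(at_pt_extend h); apply: (hQ_fun HQ) => //.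
by apply: hsec_restr (extend_hsec h) => //; [exact: fr_open | move=> y []].
Qed.

Lemma Q_scale U f F x es : open U -> fs_O U f -> is_form U F -> U x ->
  Q U (fun y s => f y * F y s) x es =
  - pmul (fun s => rho_ext rho s f) (F x) es + f x * Q U F x es.
Proof.
move=> oU fU fF Ux; have ff := form_of_fun E oU fU.
have d0 : form_deg U (of_fun E f) 0.
  by move=> y [|h s] _ /=; rewrite ?eqxx // /sdeg big_nil oppr0.
have e y s : U y -> f y * F y s = fmul (of_fun E f) F y s.
  by move=> _; rewrite fmulE pmul_fun.
rewrite (Q_ext oU (form_fscale char0 oU fU fF) e) //.
rewrite (hQ_derivation HQ oU ff fF d0) // expr0z mul1r !fmulE pmul_fun.
congr (_ + _); rewrite -mulN1r -pmulZl; apply: eq_pmul => // s.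
by rewrite Q_of_fun // mulN1r.
Qed.

Lemma Q_form_scale U (c : K) F x es : open U -> is_form U F -> U x ->
  Q U (fun y s => c * F y s) x es = c * Q U F x es.
Proof.
move=> oU fF Ux; have f0 := form0 E oU.
have z : Q U (fun _ _ => 0) x es = 0.
  have e y (s : seq (hvec E y)) : U y -> 1 * 0 + 0 = 0 :> K by rewrite mul1r addr0.
  have := hQ_linear HQ 1 oU f0 f0 es Ux.
  rewrite (Q_ext oU (form_linear char0 1 oU f0 f0) e) // mul1r => h.
  by apply: (addIr (Q U (fun _ _ => 0) x es)); rewrite -h add0r.
have e y (s : seq (hvec E y)) : U y -> c * F y s + 0 = c * F y s by rewrite addr0.
rewrite -(Q_ext oU (form_linear char0 c oU fF f0) e) // (hQ_linear HQ) //.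
by rewrite z addr0.
Qed.

End AnchorAndQ.

(** * Connections evaluated on words of vectors *)

Section ConnectionToOperator.
Variables (K : fieldType) (X : fspace K) (E V : gbundle X) (L : lie_infty_algebroid E).
Hypothesis char0 : [pchar K] =i pred0.
Variable Q : set X -> sform E -> sform E.
Arguments Q : clear implicits.
Hypothesis HQ : is_homological L Q.
Variable nabla : taylor E V.
Arguments nabla : clear implicits.
Hypothesis cn : is_connection L nabla.
Implicit Types (U W : set X) (x : X) (f g : X -> K) (w : vform E V) (v : hsec V).
Local Notation rho := (li_rho L).
Local Notation ks := (@ksign K).

(** The letters are exchanged one by one from the left, the prefix [p] in the proof holding those
    already exchanged. The section [v] is the same on both sides because one-letter words
    differentiate it. *)
Lemma nabla_tensor U1 U2 x es es' v n : open U1 -> open U2 -> U1 x -> U2 x ->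
  all_hsec U1 es -> all_hsec U2 es' -> is_hsec U1 v -> is_hsec U2 v ->
  pts x es = pts x es' -> nabla U1 es v n x = nabla U2 es' v n x.
Proof.
move=> oU1 oU2 U1x U2x hes hes' hv1 hv2 ees.
pose U := U1 `&` U2; have oU : open U by exact: openI.
have Ux : U x by [].
have s1 : U `<=` U1 by move=> y [].
have s2 : U `<=` U2 by move=> y [].
have hv : is_hsec U v by exact: hsec_restr hv1.
rewrite (cn_local cn oU1 oU s1 hes (all_hsec_restr oU1 oU s1 hes) hv1 hv) //.
rewrite (cn_local cn oU2 oU s2 hes' (all_hsec_restr oU2 oU s2 hes') hv2 hv) //.
have {}hes := all_hsec_restr oU1 oU s1 hes.
have {}hes' := all_hsec_restr oU2 oU s2 hes'.
suff H p : all_hsec U p -> nabla U (p ++ es) v n x = nabla U (p ++ es') v n x.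
  by apply: (H [::]); exact: all_hsec_nil.
elim: es es' hes hes' ees p => [|[d s] es IH] [|[d' s'] es'] // + + ees p hp.
have ed := Some_inj (congr1 ohead ees); have es_eq := congr1 behead ees.
move=> /all_hsec_cons[hs hes] /all_hsec_cons[hs' hes'].
have [edd _] := at_pt_inj ed; rewrite /= in edd; subst d'.
have ss' : s x = s' x by exact: Hvec_inj ed.
have hpr W r : open W -> W `<=` U -> bsec W r -> all_hsec W (p ++ Hsec r :: es).
  move=> oW WU hr; apply/all_hsec_cat; split; first exact: all_hsec_restr hp.
  by apply/all_hsec_cons; split=> //; exact: all_hsec_restr hes.
have -> : nabla U (p ++ Hsec s :: es) v n x = nabla U (p ++ Hsec s' :: es) v n x.
  apply: (@slot_tensor _ _ _ _ x U d (fun W r => nabla W (p ++ Hsec r :: es) v n x))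
    => //.
  - move=> W W' r t oW oW' W'W WU W'x hr ht rt.
    have W'U : W' `<=` U by move=> y /W'W/WU.
    apply: (cn_local cn oW oW' W'W); rewrite ?inE //.
    + exact: hpr.
    + exact: hpr.
    + exact: hsec_restr hv.
    + exact: hsec_restr hv.
    + by move=> y W'y; split=> //; rewrite !pts_cat /= /at_pt /= rt.
  - move=> W r t oW WU Wx hr ht; apply: (cn_add cn) => //; try exact: hpr.
    exact: hsec_restr hv.
  - move=> W f r oW WU Wx hf hr; apply: (cn_linear cn) => //; try exact: hpr.
    exact: hsec_restr hv.
rewrite -!cat_rcons; apply: IH => //.
by rewrite -cats1; apply/all_hsec_cat; split=> //; apply/all_hsec_cons; split=> //; exact: all_hsec_nil.
Qed.

(** Only the letters from E become vectors at [x]; [v] has to remain a section. *)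
Definition pnab U v n x (es : seq (hvec E x)) : V n x :=
  nabla (U `&` fr_dom E x) [seq extend e | e <- es] v n x.

Lemma pnab_pts U U' x es v n : open U -> open U' -> U' `<=` U -> U' x ->
  all_hsec U' es -> is_hsec U v -> pnab U v n (pts x es) = nabla U' es v n x.
Proof.
move=> oU oU' UU U'x hes hv; apply: nabla_tensor => //.
- exact: open_frI.
- by split; [exact: UU | exact: fr_mem].
- exact: all_hsec_extendI.
- by apply: hsec_restr hv => //; exact: open_frI.
- exact: hsec_restr hv.
- exact: pts_extend.
Qed.

Section Fixed.
Variables (U : set X) (v : hsec V).
Hypotheses (oU : open U) (hv : is_hsec U v).

Let W x := U `&` fr_dom E x.
Let oW x : open (W x). Proof. exact: open_frI. Qed.
Let WU x : W x `<=` U. Proof. by move=> y []. Qed.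
Let Wx x : U x -> W x x. Proof. by move=> Ux; split=> //; exact: fr_mem. Qed.
Let hW x (e : hvec E x) : is_hsec (W x) (extend e).
Proof. exact: extend_hsecI. Qed.
Let hWs x (es : seq (hvec E x)) : all_hsec (W x) [seq extend e | e <- es].
Proof. exact: all_hsec_extendI. Qed.
Let hvW x : is_hsec (W x) v.
Proof. by apply: hsec_restr hv => //; exact: oW. Qed.

Arguments hW : clear implicits.
Arguments hWs : clear implicits.
Arguments hvW : clear implicits.

Lemma pnab_deg n x es : U x -> n != wdeg es + tag v + 1 -> pnab U v n (x := x) es = 0.
Proof.
move=> Ux ne; apply: (cn_degree cn) => //; rewrite ?/W //; try exact: oW; try exact: Wx.
- exact: hWs.
- exact: hvW.
by rewrite -(wdeg_pts x) pts_extend.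
Qed.

Lemma pnab_sym n x (p : seq (hvec E x)) a b q : U x ->
  pnab U v n (p ++ a :: b :: q) = ks (tag a) (tag b) *: pnab U v n (p ++ b :: a :: q).
Proof.
move=> Ux; rewrite /pnab !map_cat /=; apply: (cn_sym cn); [exact: oW| |exact: hvW|exact: Wx].
by have := hWs x (p ++ a :: b :: q); rewrite map_cat.
Qed.

Lemma pnab_lin n x (p : seq (hvec E x)) d c (u u' : E d x) q : U x ->
  pnab U v n (p ++ Hvec (c *: u + u') :: q) =
  c *: pnab U v n (p ++ Hvec u :: q) + pnab U v n (p ++ Hvec u' :: q).
Proof.
move=> Ux; pose s := projT2 (extend (Hvec u)); pose t := projT2 (extend (Hvec u')).
have hs : bsec (W x) s := hW x (Hvec u); have ht : bsec (W x) t := hW x (Hvec u').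
have sx : s x = u by have := at_pt_extend (Hvec u); exact: Hvec_inj.
have tx : t x = u' by have := at_pt_extend (Hvec u'); exact: Hvec_inj.
have hcs : bsec (W x) (fun y => c *: s y) by apply: bsecZ => //; exact: fs_cst.
have hcst := bsecD (oW x) hcs ht.
have all r : bsec (W x) r ->
    all_hsec (W x) ([seq extend e | e <- p] ++ Hsec r :: [seq extend e | e <- q]).
  by move=> hr; apply/all_hsec_cat; split=> //; apply/all_hsec_cons.
rewrite [LHS](nabla_tensor (U2 := W x) n (es' := [seq extend e | e <- p] ++
  Hsec (fun y => c *: s y + t y) :: [seq extend e | e <- q])) //;
  try exact: oW; try exact: Wx; try exact: hWs; try exact: all; try exact: hvW.
  rewrite (cn_add cn); [|exact: oW|exact: all|exact: all|exact: hvW|exact: Wx].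
  rewrite (cn_linear cn); [|exact: oW|exact: fs_cst|exact: all|exact: hvW|exact: Wx].
  by rewrite /pnab !map_cat.
by rewrite pts_extend pts_cat /= !pts_extend /at_pt /= sx tx.
Qed.

(** For fixed [n] and [v] only words of degree [n - tag v - 1] contribute, and the negative grading
    turns this into a bound on their length. *)
Lemma pnab_form W0 (a : dsection V) n : open W0 -> W0 `<=` U -> is_dual W0 a ->
  is_form W0 (fun x es => a x (Hvec (pnab U v n es))).
Proof.
move=> oW0 W0U da.
apply: form_of_smf => //; apply: (smf_of_homogeneous (d := - (n - tag v - 1))
  (li_negative (li_laws L))) => //.
- move=> x W0x p b c q; rewrite pnab_sym; last exact: W0U.
  rewrite -[X in a x (Hvec X)]addr0 (dual_hlin da W0x).
  by rewrite (hlin0 _ (dual_hlin da W0x)) addr0.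
- move=> x W0x p d c u u' q; rewrite pnab_lin; last exact: W0U.
  exact: dual_hlin da W0x _ _ _ _.
- move=> U' oU' UU es hes.
  have U'U : U' `<=` U by move=> y /UU/W0U.
  apply: (fs_ext (f := fun x => a x (Hvec (nabla U' es v n x)))) => //.
    by move=> x U'x; rewrite (pnab_pts (U' := U')).
  have [_ ra] := da; apply: ra => //; apply: (cn_section cn) => //.
  exact: hsec_restr hv.
move=> x es W0x; rewrite -/(wdeg es) opprK => nz; apply/eqP; apply: contraNT nz => ne.
rewrite pnab_deg ?(hlin0 _ (dual_hlin da W0x)) //; first exact: W0U.
by apply: contraNneq ne => ->; apply/eqP; ring.
Qed.

End Fixed.

End ConnectionToOperator.

(** * The operator of a connection *)

Section DualOperator.
Variables (K : fieldType) (X : fspace K) (E V : gbundle X) (L : lie_infty_algebroid E).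
Hypothesis char0 : [pchar K] =i pred0.
Variable Q : set X -> sform E -> sform E.
Arguments Q : clear implicits.
Hypothesis HQ : is_homological L Q.
Variable nabla : taylor E V.
Arguments nabla : clear implicits.
Hypothesis cn : is_connection L nabla.
Implicit Types (U W : set X) (x : X) (f g : X -> K) (w : vform E V) (v : hsec V).
Local Notation rho := (li_rho L).
Local Notation ks := (@ksign K).
Local Notation pn := (pnab nabla).

(** The value of [nabla] is read off in the one degree where it can be nonzero, and the power of
    [-1] is the parity of that degree. In contrast to [pmul] there is no [ksign] between the two
    subwords. *)
Definition ncomp U w v x (es : seq (hvec E x)) : K :=
  \sum_(m : (size es).-tuple bool)
    ueps K m (vdegs es) * (-1) ^ (wdeg (cmask m es) + tag v + 1) *
    w x (mask m es) (Hvec (pn U v (wdeg (cmask m es) + tag v + 1) (cmask m es))).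

Definition dualc U w v : sform E := fun x es =>
  (-1) ^ (tag v) * Q U (vat v w) x es + ncomp U w v es.
Arguments dualc U w v x es : clear implicits.

(** The left factor in [ncomp_frame]; its twist compensates for the [ksign] present in [pmul] and
    absent from [ncomp]. *)
Definition ncA w v (u : hsec V) : sform E := fun x s =>
  (-1) ^ (tag u) * twf (1 + tag v + tag u) (vat u w) x s.
Arguments ncA w v u x s : clear implicits.

(** Expanding the values of [nabla] in a frame of V turns the sum into shuffle products, to which
    associativity and graded commutativity apply. *)
Lemma ncomp_frame U W (Fr : gframe V) w v x (es : seq (hvec E x)) :
  open U -> is_hsec U v -> is_gframe W Fr -> W x -> U x ->
  (forall s, hlin (w x s)) ->
  ncomp U w v es = \sum_i pmul (ncA w v (@gf_sec _ _ _ Fr i) x)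
    (fun s => gf_dual i (Hvec (pn U v (tag (gf_sec i)) s))) es.
Proof.
move=> oU hv fW Wx Ux lw; rewrite /pmul exchange_big /=; apply: eq_bigr => m _.
set c := cmask m es; set n := wdeg c + tag v + 1.
rewrite (gframe_expand _ fW Wx (lw _)) mulr_sumr; apply: eq_bigr => i _.
have [e|ne] := eqVneq (tag (@gf_sec _ _ _ Fr i)) n; last first.
  rewrite (pnab_deg cn oU hv Ux ne) (hlin0 _ (dual_hlin (gf_dual_ok fW i) Wx)).
  have z : gf_dual i (Hvec (pn U v n c)) = 0.
    by apply: (dual_degN (gf_deg fW (i := i)) Wx); rewrite opprK eq_sym.
  by rewrite z !(mul0r, mulr0).
rewrite /ncA /twf /tw /vat e; set d := gf_dual _ _.
(* Modulo 2 the twist is by the degree of the subword [c], hence equal to the [ksign] of the two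
   subwords. *)
have -> : 1 + tag v + n = n + n - wdeg c by rewrite /n; ring.
rewrite (ksDr _ _ (n + n)) ksNr (ksDr _ _ n n) ks_sq mul1r.
set A := ks _ _; set B := w _ _ _; set C := ueps _ _ _; set s := (-1) ^ n.
by rewrite -[LHS]mul1r -(ks_sq K (wdeg (mask m es)) (wdeg c)) -/A; ring.
Qed.

Lemma pnab_local U U' v v' x n (es : seq (hvec E x)) : open U -> open U' ->
  U' `<=` U -> U' x -> is_hsec U v -> is_hsec U' v' ->
  (forall y, U' y -> at_pt y v = at_pt y v') -> pn U v n es = pn U' v' n es.
Proof.
move=> oU oU' UU U'x hv hv' vv'; rewrite /pnab.
have o1 : open (U `&` fr_dom E x) by exact: open_frI.
have o2 : open (U' `&` fr_dom E x) by exact: open_frI.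
have s12 : U' `&` fr_dom E x `<=` U `&` fr_dom E x by move=> y [/UU].
apply: (cn_local cn o1 o2 s12).
- exact: all_hsec_extendI.
- exact: all_hsec_extendI.
- exact: hsec_restr hv.
- exact: hsec_restr hv'.
- by move=> y [U'y _]; rewrite vv'.
- by split=> //; exact: fr_mem.
Qed.

Lemma dualc_local U U' w w' v v' x es : open U -> open U' -> U' `<=` U -> U' x ->
  is_vform U w -> is_vform U' w' -> is_hsec U v -> is_hsec U' v' ->
  (forall y s u, U' y -> w y s u = w' y s u) ->
  (forall y, U' y -> at_pt y v = at_pt y v') ->
  dualc U w v x es = dualc U' w' v' x es.
Proof.
move=> oU oU' UU U'x vw vw' hv hv' ww' vv'.
have tv : tag v = tag v' := congr1 tag (vv' x U'x).
rewrite /dualc tv; congr (_ * _ + _).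
  apply: (hQ_local HQ oU oU' UU) => //.
  - exact: (vform_form char0 (U := U)).
  - exact: (vform_form char0 (U := U')).
  - by move=> y s U'y; rewrite /vat ww' // vv'.
rewrite /ncomp tv; apply: eq_bigr => m _; rewrite ww' //.
by rewrite (pnab_local _ _ oU oU' UU U'x hv hv' vv').
Qed.

Lemma dualc_linw U c w w' v x es : open U -> U x -> is_vform U w -> is_vform U w' ->
  is_hsec U v ->
  dualc U (fun y s u => c * w y s u + w' y s u) v x es =
  c * dualc U w v x es + dualc U w' v x es.
Proof.
move=> oU Ux vw vw' hv; rewrite /dualc.
rewrite (hQ_linear HQ c oU (vform_form char0 oU (@subset_refl _ _) hv vw)
  (vform_form char0 oU (@subset_refl _ _) hv vw')) //.
have -> : ncomp U (fun y s u => c * w y s u + w' y s u) v es =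
    c * ncomp U w v es + ncomp U w' v es.
  by rewrite /ncomp mulr_sumr -big_split; apply: eq_bigr => m _ /=; ring.
by ring.
Qed.

Lemma dualc_add U w d (s t : forall y, V d y) x es : open U -> U x -> is_vform U w ->
  bsec U s -> bsec U t ->
  dualc U w (Hsec (fun y => s y + t y)) x es =
  dualc U w (Hsec s) x es + dualc U w (Hsec t) x es.
Proof.
move=> oU Ux vw hs ht; rewrite /dualc /=.
have fs := vform_form (e := Hsec s) char0 oU (@subset_refl _ _) hs vw.
have ft := vform_form (e := Hsec t) char0 oU (@subset_refl _ _) ht vw.
have est y r : U y -> 1 * vat (Hsec s) w y r + vat (Hsec t) w y r =
    vat (Hsec (fun y => s y + t y)) w y r.
  move=> Uy; rewrite /vat /at_pt /= -(vform_hlin char0 r vw Uy).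
  by rewrite scale1r.
rewrite -(Q_ext HQ oU (form_linear char0 1 oU fs ft) est) // (hQ_linear HQ) //.
rewrite mul1r mulrDr -!addrA; congr (_ + _); rewrite addrCA; congr (_ + _).
rewrite /ncomp -big_split; apply: eq_bigr => m _ /=; rewrite -mulrDr; congr (_ * _).
have W_o : open (U `&` fr_dom E x) by exact: open_frI.
rewrite /pnab (cn_addv cn) //.
- by rewrite -[X in _ = X + _]mul1r -(vform_hlin char0 _ vw Ux) scale1r.
- exact: all_hsec_extendI.
- exact: bsec_restr hs.
- exact: bsec_restr ht.
- by split=> //; exact: fr_mem.
Qed.

Lemma pnab_leibniz U d (s : forall y, V d y) f n x (es : seq (hvec E x)) :
  open U -> U x -> fs_O U f -> bsec U s ->
  pn U (Hsec (fun y => f y *: s y)) n es =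
  f x *: pn U (Hsec s) n es + rho_ext rho es f *: tot (Hsec s) n x.
Proof.
move=> oU Ux fU hs; rewrite /pnab.
have oW : open (U `&` fr_dom E x) by exact: open_frI.
have Wx : (U `&` fr_dom E x) x by split=> //; exact: fr_mem.
have fW : fs_O (U `&` fr_dom E x) f by exact: fs_restr fU.
have hsW : bsec (U `&` fr_dom E x) s by exact: bsec_restr hs.
have hes : all_hsec (U `&` fr_dom E x) [seq extend e | e <- es].
  exact: all_hsec_extendI.
have [sz|/eqP sz] := eqVneq (size es) 1%N; last first.
  by rewrite (cn_linearv cn) ?size_map // rho_ext_size // scale0r addr0.
case: es sz hes => [//|e [|//]] _ /all_hsec_cons[he _].
by rewrite /= (cn_leibniz cn) // at_pt_extend.
Qed.

Lemma dualc_scale U w d (s : forall y, V d y) f x es : open U -> U x -> is_vform U w ->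
  fs_O U f -> bsec U s ->
  dualc U w (Hsec (fun y => f y *: s y)) x es = f x * dualc U w (Hsec s) x es.
Proof.
move=> oU Ux vw fU hs; rewrite /dualc /=.
have fs := vform_form (e := Hsec s) char0 oU (@subset_refl _ _) hs vw.
have lw r : hlin (w x r) by exact: (vform_hlin char0 r vw Ux).
have est y r : U y -> f y * vat (Hsec s) w y r =
    vat (Hsec (fun y => f y *: s y)) w y r.
  move=> Uy; have lwy := vform_hlin char0 r vw Uy.
  rewrite /vat /at_pt /= -[f y *: s y]addr0 lwy.
  by rewrite (hlin0 _ lwy) addr0.
rewrite -(Q_ext HQ oU (form_fscale char0 oU fU fs) est) //.
rewrite (Q_scale char0 HQ) //.
pose Fr := fr V x; have fF := fr_ok V x; have Fx := fr_mem V x.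
have hfs : bsec U (fun y => f y *: s y) by exact: bsecZ.
rewrite (ncomp_frame (v := Hsec (fun y => f y *: s y)) es oU hfs fF Fx Ux lw).
rewrite (ncomp_frame (v := Hsec s) es oU hs fF Fx Ux lw).
(* The [c i] are the coordinates of [s x], and [R] is the one-form given by the anchor applied to
   [f]; both Leibniz defects are products with [R]. *)
pose c i := @gf_dual _ _ _ Fr i x (Hvec (s x)).
pose R es' := rho_ext rho (x := x) es' f.
have cE i : gf_dual i (Hvec (tot (Hsec s) (tag (@gf_sec _ _ _ Fr i)) x)) = c i.
  have dl := dual_hlin (gf_dual_ok fF i) Fx.
  have [e|ne] := eqVneq d (tag (@gf_sec _ _ _ Fr i)).
    by rewrite (at_pt_tot (e := Hsec s)).
  rewrite tot_out // (hlin0 _ dl); apply/esym.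
  by apply: (dual_degN (gf_deg fF (i := i)) Fx); rewrite opprK.
under eq_bigr => i _.
  have e : (fun r => gf_dual i (Hvec (pn U (Hsec (fun y => f y *: s y))
      (tag (@gf_sec _ _ _ Fr i)) r))) =1
    (fun r => f x * gf_dual i (Hvec (pn U (Hsec s) (tag (gf_sec i)) r)) + c i * R r).
    move=> r; have dl := dual_hlin (gf_dual_ok fF i) Fx.
    rewrite pnab_leibniz // dl -cE; congr (_ + _).
    by rewrite -[_ *: tot _ _ _]addr0 dl (hlin0 _ dl) addr0 mulrC.
  rewrite (eq_pmul (frefl _) e) pmul_linr pmulZr.
  over.
rewrite big_split /= -mulr_sumr.
(* The defect of [nabla] stands on the left; the right-hand side is minus the defect of the Q term.
   Where [c i] is nonzero, [gf_sec i] has degree [d], so [ncA] is twisted by [1 + d + d]: precisely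
   the sign for commuting [R], of degree 1, to the other side. *)
suff -> : \sum_i c i * pmul (ncA w (Hsec (fun y => f y *: s y)) (gf_sec i) x) R es =
    (-1) ^ d * pmul R (vat (Hsec s) w x) es.
  set q := Q _ _ _ _; set r := pmul _ _ _; set z := \sum_i _.
  by rewrite /R -/r; ring.
have R1 : pdeg R 1 by move=> r /rho_ext_deg.
rewrite (pmulC _ R1).
under eq_bigr do rewrite -pmulZl.
rewrite -pmul_suml -pmulZl; apply: eq_pmul => // r.
rewrite [in RHS]/tw.
have -> : vat (Hsec s) w x r = \sum_i c i * w x r (at_pt x (gf_sec i)).
  exact: (gframe_expand (Hvec (s x)) fF Fx (lw r)).
rewrite !mulr_sumr.
apply: eq_bigr => i _.
have [->|/(gf_deg fF Fx)] := eqVneq (c i) 0; first by rewrite !(mul0r, mulr0).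
rewrite opprK /= /ncA /twf /tw /vat => <- /=.
by rewrite -addrA !ksDr ks_sq mulr1; ring.
Qed.

Lemma dualc_tensor U0 U U' w v v' x es : open U0 -> open U -> open U' ->
  U `<=` U0 -> U' `<=` U0 -> U x -> U' x -> is_vform U0 w ->
  is_hsec U v -> is_hsec U' v' -> at_pt x v = at_pt x v' ->
  dualc U w v x es = dualc U' w v' x es.
Proof.
move=> oU0 oU oU' UU0 U'U0 Ux U'x vw hv hv' vv'.
have [] := at_pt_inj vv'; case: v v' hv hv' vv' => d s [d' s'] hv hv' vv' /= dd' _.
subst d'; have ss' : s x = s' x := Hvec_inj vv'.
apply: (@slot_tensor _ _ _ K^o x U0 d (fun W r => dualc W w (Hsec r) x es)) => //.
- exact: UU0.
- move=> W W' r t oW oW' W'W WU W'x hr ht rt.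
  apply: dualc_local => //; try exact: vform_restr vw.
    by apply: (vform_restr char0 oW' _ vw) => y /W'W/WU.
  by move=> y W'y; rewrite /at_pt /= rt.
- by move=> W r t oW WU Wx hr ht; apply: dualc_add => //; exact: vform_restr vw.
- by move=> W f r oW WU Wx hf hr; apply: dualc_scale => //; exact: vform_restr vw.
Qed.

Lemma ncomp_form U w v : open U -> is_vform U w -> is_hsec U v ->
  is_form U (fun x es => ncomp U w v (x := x) es).
Proof.
move=> oU vw hv; apply: form_local => x Ux; pose W := fr_dom V x `&` U.
have oW : open W by apply: openI => //; exact: fr_open.
have fW : is_gframe W (fr V x).
  by apply: is_gframe_restr (fr_ok V x) => //; [exact: fr_open | move=> y []].
have WU : W `<=` U by move=> y [].
exists W; split=> //; first by split=> //; exact: fr_mem.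
apply: (form_ext (F := fun y es => \sum_i fmul (ncA w v (@gf_sec _ _ _ (fr V x) i))
  (fun z s => gf_dual i (Hvec (pn U v (tag (gf_sec i)) s))) y es)).
  move=> y es Wy; rewrite (ncomp_frame es oU hv fW Wy (WU y Wy)) // => s.
  exact: (vform_hlin char0 s vw (WU y Wy)).
apply: form_sum => // i; apply: form_mul => //.
  apply: form_scale; apply: form_tw => //; apply: (vform_form char0 (U := U)) => //.
  exact: (gf_sec_ok fW i).
exact: (pnab_form char0 cn oU hv _ oW WU (gf_dual_ok fW i)).
Qed.

Lemma dualc_form U w v : open U -> is_vform U w -> is_hsec U v ->
  is_form U (dualc U w v).
Proof.
move=> oU vw hv; apply: form_linear => //; last exact: ncomp_form.
apply: (hQ_section HQ oU); exact: (vform_form char0 (U := U)).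
Qed.

(** By [dualc_tensor] any other extension of [h] to a section gives the same value. *)
Definition dual_op : operator E V := fun U w x es h =>
  dualc (U `&` fr_dom V x) w (extend h) x es.
Arguments dual_op U w x es h : clear implicits.

Lemma dual_op_at U U' w v x es : open U -> open U' -> U' `<=` U -> U' x ->
  is_vform U w -> is_hsec U' v -> dual_op U w x es (at_pt x v) = dualc U' w v x es.
Proof.
move=> oU oU' UU U'x vw hv.
have oW : open (U `&` fr_dom V x) by exact: open_frI.
apply: (dualc_tensor (U0 := U)) => //.
- by split; [exact: UU | exact: fr_mem].
- exact: extend_hsecI.
- exact: at_pt_extend.
Qed.

Lemma dual_op_vform U w : open U -> is_vform U w -> is_vform U (dual_op U w).
Proof.
move=> oU vw; apply: vform_of_smvf => //; split=> [x es Ux d c u u'|U' e oU' UU he].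
  pose W := U `&` fr_dom V x.
  have oW : open W by exact: open_frI.
  have WU : W `<=` U by move=> y [].
  have Wx : W x by split=> //; exact: fr_mem.
  have hW h : is_hsec W (@extend _ _ V x h).
    exact: extend_hsecI.
  pose s := projT2 (extend (Hvec u)); pose t := projT2 (extend (Hvec u')).
  have sx : Hvec (s x) = Hvec u := at_pt_extend (Hvec u).
  have tx : Hvec (t x) = Hvec u' := at_pt_extend (Hvec u').
  have hs : bsec W s := hW (Hvec u); have ht : bsec W t := hW (Hvec u').
  have hcs : bsec W (fun y => c *: s y) := bsecZ oW (fs_cst c oW) hs.
  have hst := bsecD oW hcs ht.
  have e : Hvec (c *: u + u') = at_pt x (Hsec (fun y => c *: s y + t y)).
    by rewrite /at_pt /= (Hvec_inj sx) (Hvec_inj tx).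
  have eu := etrans (congr1 (dual_op U w x es) (esym sx))
    (dual_op_at es oU oW WU Wx vw hs).
  have eu' := etrans (congr1 (dual_op U w x es) (esym tx))
    (dual_op_at es oU oW WU Wx vw ht).
  have vwW := vform_restr char0 oW WU vw.
  rewrite e (dual_op_at es oU oW WU Wx vw) // eu eu' dualc_add //.
  by rewrite (dualc_scale es oW Wx vwW (fs_cst c oW) hs).
apply: (form_ext (F := dualc U' w e)).
  by move=> x es U'x; rewrite /vat (dual_op_at es oU oU' UU U'x vw he).
by apply: dualc_form => //; exact: (vform_restr char0 oU' UU vw).
Qed.

Lemma dual_op_deg U w d : open U -> is_vform U w -> vform_deg U w d ->
  vform_deg U (dual_op U w) (d + 1).
Proof.
move=> oU vw dw x es h Ux; pose W := U `&` fr_dom V x.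
have oW : open W by exact: open_frI.
have WU : W `<=` U by move=> y [].
have Wx : W x by split=> //; exact: fr_mem.
have hW : is_hsec W (extend h).
  exact: extend_hsecI.
have vwW := vform_restr char0 oW WU vw.
have fe := vform_form char0 oW (@subset_refl _ _) hW vwW.
have de : form_deg W (vat (extend h) w) (d + tag h).
  move=> y s /WU Uy; rewrite /vat => /(dw y s _ Uy) /=.
  rewrite -/(wdeg s) => e; apply: (addIr (tag h)); rewrite e; ring.
have dQ := hQ_degree HQ oW fe de.
rewrite -/(wdeg es) /dual_op -/W /dualc.
have [q0|/(dQ x es Wx)] := eqVneq (Q W (vat (extend h) w) x es) 0; last first.
  by rewrite -/(wdeg es) => -> _; ring.
rewrite q0 mulr0 add0r => nz.
have [m nm] : exists m : (size es).-tuple bool, w x (mask m es) (Hvec (pn W (extend h)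
    (wdeg (cmask m es) + tag (extend h) + 1) (cmask m es))) != 0.
  apply: contraNP nz => H; rewrite /ncomp big1 // => m _.
  have [->|ne] := eqVneq (w x (mask m es) (Hvec (pn W (extend h)
    (wdeg (cmask m es) + tag (extend h) + 1) (cmask m es)))) 0; first by rewrite mulr0.
  by case: H; exists m.
have := dw x _ _ Ux nm; rewrite -/(wdeg _) -(wdeg_mask (size_tuple m)) /= => e.
by apply: (addIr 1); rewrite opprD addrNK -e; ring.
Qed.

(** Only the Q term differentiates [F], through the derivation rule of Q; in the [nabla] term [F] is
    a left factor of each product and comes out by associativity. *)
Lemma dual_op_leibniz U F w d x es h : open U -> is_form U F -> form_deg U F d ->
  is_vform U w -> U x ->
  dual_op U (fscale F w) x es h =
  fscale (Q U F) w x es h + (-1) ^ d * fscale F (dual_op U w) x es h.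
Proof.
move=> oU fF dF vw Ux; pose W := U `&` fr_dom V x.
have oW : open W by exact: open_frI.
have WU : W `<=` U by move=> y [].
have Wx : W x by split=> //; exact: fr_mem.
have hW : is_hsec W (extend h).
  exact: extend_hsecI.
have vwW := vform_restr char0 oW WU vw.
have fFW := form_restr char0 oW WU fF.
have fe := vform_form char0 oW (@subset_refl _ _) hW vwW.
have dFW : form_deg W F d by move=> y s /WU; apply: dF.
have dFx : pdeg (F x) d by move=> s; exact: dF.
have dQx : pdeg (Q U F x) (d + 1) by move=> s; exact: (hQ_degree HQ oU fF dF).
have vFw := vform_fscale char0 oU fF vw.
rewrite {1}/dual_op -/W /dualc !fscaleE.
set t := tag h; rewrite -/t.
(* Contracting [fscale F w] with a vector of degree [t] carries that vector past [F], of degree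
   [d]. *)
have e1 y s : W y -> ks d t * fmul F (vat (extend h) w) y s =
    vat (extend h) (fscale F w) y s.
  move=> Wy; have dFy : pdeg (F y) d by move=> r; apply: dF; exact: WU.
  rewrite /vat fscaleE fmulE -pmulZl; apply: eq_pmul => // r.
  by rewrite (pdeg_tw _ dFy).
have fm := form_mul char0 oW fFW fe.
rewrite -(Q_ext HQ oW (form_scale (ks d t) fm) e1) //.
rewrite (Q_form_scale char0 HQ _ _ oW fm) //.
rewrite (hQ_derivation HQ oW fFW fe dFW) // !fmulE.
have QE s : Q W F x s = Q U F x s.
  by apply/esym/(hQ_local HQ oU oW WU fF fFW).
rewrite (eq_pmul QE (frefl _)) {QE}.
rewrite (eq_pmul (pdeg_tw t dFx) (frefl _)) (eq_pmul (pdeg_tw t dQx) (frefl _)) !pmulZl.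
have eD : (fun s => dual_op U w x s h) =1 (fun s => (-1) ^ t * Q W (vat (extend h) w) x s
    + ncomp W w (extend h) s) by [].
rewrite (eq_pmul (frefl _) eD) pmul_linr.
have lw s : hlin (w x s) := vform_hlin char0 s vw Ux.
have lFw s : hlin (fscale F w x s) := vform_hlin char0 s vFw Ux.
have fV := fr_ok V x; have Vx := fr_mem V x.
rewrite (ncomp_frame es oW hW fV Vx Wx lFw).
have eN : (fun s => ncomp W w (extend h) s) =1 (fun s => \sum_i pmul
   (ncA w (extend h) (@gf_sec _ _ _ (fr V x) i) x)
    (fun s => gf_dual i (Hvec (pn W (extend h) (tag (gf_sec i)) s))) s).
  by move=> s; rewrite (ncomp_frame s oW hW fV Vx Wx lw).
rewrite (eq_pmul (frefl _) eN) pmul_sumr.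
have -> : \sum_i pmul (ncA (fscale F w) (extend h) (@gf_sec _ _ _ (fr V x) i) x)
    (fun s => gf_dual i (Hvec (pn W (extend h) (tag (gf_sec i)) s))) es =
  (-1) ^ d * ks d t * \sum_i pmul (F x) (pmul
   (ncA w (extend h) (@gf_sec _ _ _ (fr V x) i) x)
    (fun s => gf_dual i (Hvec (pn W (extend h) (tag (gf_sec i)) s)))) es.
  rewrite mulr_sumr; apply: eq_bigr => i _; rewrite -pmulA -pmulZl.
  apply: eq_pmul => // s; set b := tag (gf_sec i).
  rewrite /ncA -/b /= -/t pmulZr [RHS]mulrCA; congr (_ * _).
  have ev : vat (gf_sec i) (fscale F w) x =1 (fun s => ks d b *
      pmul (F x) (vat (gf_sec i) w x) s).
    move=> r; rewrite /vat fscaleE -pmulZl; apply: eq_pmul => // r'.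
    by rewrite (pdeg_tw _ dFx).
  rewrite /twf (eq_tw _ ev).
  have -> : tw (1 + t + b) (fun r => ks d b * pmul (F x) (vat (gf_sec i) w x) r) s =
      ks d b * tw (1 + t + b) (pmul (F x) (vat (gf_sec i) w x)) s.
    by rewrite /tw mulrCA.
  rewrite tw_pmul (eq_pmul (pdeg_tw _ dFx) (frefl _)) pmulZl mulrA; congr (_ * _).
  (* The twist by [1 + t + b] acts on [F] as a sign; its part in [b] cancels the sign from
     contracting with [gf_sec i], and [(-1) ^ d * ks d t] remains. *)
  by rewrite !ksDr ks1 [LHS]mulrC -[LHS]mulrA ks_sq mulr1.
have ehw : vat (extend h) w x =1 (fun s => w x s h).
  by move=> s; rewrite /vat at_pt_extend.
rewrite -(eq_pmul (frefl (Q U F x)) ehw).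
have -> : ks (d + 1) t = ks d t * (-1) ^ t by rewrite ksDl (ksC _ 1) ks1.
set q1 := pmul (Q U F x) _ _; set q2 := pmul (F x) _ _; set q3 := \sum_i _.
set a := (-1) ^ t; set b := (-1) ^ d; set c := ks d t.
by ring.
Qed.

Lemma dual_op_is_operator : is_leibniz_operator Q dual_op.
Proof.
split.
- exact: dual_op_vform.
- move=> U U' w w' oU oU' UU vw vw' ww' x es h U'x.
  have oW : open (U `&` fr_dom V x) by exact: open_frI.
  have oW' : open (U' `&` fr_dom V x) by exact: open_frI.
  apply: dualc_local => //.
  + by move=> y [/UU].
  + by split=> //; exact: fr_mem.
  + by apply: (vform_restr char0 oW _ vw).
  + by apply: (vform_restr char0 oW' _ vw').
  + exact: extend_hsecI.
  + exact: extend_hsecI.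
  + by move=> y s u [U'y _]; exact: ww'.
- move=> U c w w' oU vw vw' x es h Ux.
  have oW : open (U `&` fr_dom V x) by exact: open_frI.
  apply: dualc_linw => //.
  + by split=> //; exact: fr_mem.
  + by apply: (vform_restr char0 oW _ vw).
  + by apply: (vform_restr char0 oW _ vw').
  + exact: extend_hsecI.
- exact: dual_op_deg.
- move=> U F w d oU fF dF vw x es h Ux; exact: dual_op_leibniz.
Qed.

(** As [of_vdual E a] lives on the empty word, [ncomp] keeps only the unshuffle that gives all
    letters to [nabla], while the Q term is Q of the function obtained by pairing [a] with [v]. *)
Lemma dual_op_corresponds : corresponds L nabla dual_op.
Proof.
move=> U a d es v x oU da dega hes hv Ux.
have va := vform_of_vdual E char0 oU da.
rewrite (dual_op_at _ oU oU (@subset_refl _ _) Ux va hv) /dualc addrC.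
have fV := fr_ok V x; have Vx := fr_mem V x.
have la s : hlin (of_vdual E a x s) := vform_hlin char0 s va Ux.
rewrite (ncomp_frame _ oU hv fV Vx Ux la); congr (_ + _).
  rewrite /dual_tot -(pnab_pts cn (- d) oU oU (@subset_refl _ _) Ux hes hv).
  rewrite (gframe_expand _ fV Vx (dual_hlin da Ux)) mulr_sumr.
  apply: eq_bigr => i _; set b := tag (gf_sec i).
  have eA : ncA (of_vdual E a) v (gf_sec i) x =1 (fun s =>
     if s is [::] then (-1) ^ b * a x (at_pt x (gf_sec i)) else 0).
    move=> s; rewrite /ncA /twf /tw vat_of_vdual /of_fun.
    by case: s => [|? ?]; rewrite ?mulr0 // wdeg_nil ks0l mul1r.
  rewrite (eq_pmul eA (frefl _)) pmul_fun.
  have [a0|nz] := eqVneq (a x (at_pt x (gf_sec i))) 0.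
    by rewrite a0 !(mulr0, mul0r).
  have e : b = - d := dega x _ Ux nz.
  by rewrite e signzN; ring.
rewrite vat_of_vdual (Q_of_fun HQ) //; last exact: dual_app_regular da hv.
(* The sign of the Q term depends on the degree of [v], that of the correspondence on [d]; they
   agree unless the pairing of [a] and [v] vanishes identically on [U]. *)
have [e|ne] := eqVneq (tag v) (- d).
  by rewrite e signzN signzD expr1z; ring.
have r0 : rho_ext rho (pts x es) (dual_app a v) = 0.
  rewrite -[RHS](rho_ext0 L (pts x es)); apply: (rho_ext_local L _ oU Ux).
    exact: dual_app_regular da hv.
  by move=> y Uy; rewrite /dual_app (dual_degN dega).
by rewrite r0 oppr0 !mulr0.
Qed.

End DualOperator.

(** * The connection of an operator, and uniqueness *)

Section Operators.
Variables (K : fieldType) (X : fspace K) (E V : gbundle X) (L : lie_infty_algebroid E).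
Hypothesis char0 : [pchar K] =i pred0.
Variable Q : set X -> sform E -> sform E.
Arguments Q : clear implicits.
Hypothesis HQ : is_homological L Q.
Implicit Types (U W : set X) (x : X) (f g : X -> K) (w : vform E V) (v : hsec V).
Local Notation rho := (li_rho L).
Local Notation ks := (@ksign K).

Section OneOperator.
Variable D : operator E V.
Arguments D : clear implicits.
Hypothesis hD : is_leibniz_operator Q D.

Lemma op_ext U w w' x es h : open U -> is_vform U w ->
  (forall y s u, U y -> w y s u = w' y s u) -> U x -> D U w x es h = D U w' x es h.
Proof.
move=> oU vw ww' Ux; apply: (op_local hD oU oU (@subset_refl _ _) vw) => //.
exact: vform_ext vw.
Qed.

Lemma op0 U x es h : open U -> U x -> D U (fun _ _ _ => 0) x es h = 0.
Proof.
move=> oU Ux; have v0 := vform0 E V char0 oU.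
have e y (s : seq (hvec E y)) (u : hvec V y) : U y -> 1 * 0 + 0 = 0 :> K.
  by rewrite mul1r addr0.
have := op_linear hD 1 oU v0 v0 es h Ux.
rewrite (op_ext _ _ oU (vform_linear char0 1 oU v0 v0) e) // mul1r => h0.
by apply: (addIr (D U (fun _ _ _ => 0) x es h)); rewrite -h0 add0r.
Qed.

Lemma op_sum (I : finType) U (w : I -> vform E V) x es h : open U -> U x ->
  (forall i, is_vform U (w i)) ->
  is_vform U (fun y s u => \sum_i w i y s u) /\
  D U (fun y s u => \sum_i w i y s u) x es h = \sum_i D U (w i) x es h.
Proof.
move=> oU Ux vw; elim: (index_enum I) => [|i r [IH1 IH2]].
  have e y (s : seq (hvec E y)) (u : hvec V y) : U y ->
      0 = \sum_(i <- [::]) w i y s u by rewrite big_nil.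
  split; first by apply: vform_ext (vform0 E V char0 oU).
  by rewrite big_nil -(op_ext _ _ oU (vform0 E V char0 oU) e) // op0.
have e y (s : seq (hvec E y)) (u : hvec V y) : U y ->
    1 * w i y s u + \sum_(j <- r) w j y s u = \sum_(j <- i :: r) w j y s u.
  by rewrite big_cons mul1r.
have vl := vform_linear char0 1 oU (vw i) IH1.
split; first exact: vform_ext vl.
by rewrite big_cons -(op_ext _ _ oU vl e) // (op_linear hD) // mul1r IH2.
Qed.

(* The correspondence formula solved for <a, nabla_es v>, with |a| = d. *)
Definition opairing U (a : dsection V) (d : int) es v x : K :=
  (-1) ^ d * D U (of_vdual E a) x (pts x es) (at_pt x v) +
  rho_ext rho (pts x es) (dual_app a v).

Lemma opairing_local U U' a a' d es es' v v' x : open U -> open U' -> U' `<=` U ->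
  U' x -> is_dual U a -> is_dual U' a' -> is_hsec U v -> is_hsec U' v' ->
  (forall y h, U' y -> a y h = a' y h) -> pts x es = pts x es' ->
  (forall y, U' y -> at_pt y v = at_pt y v') ->
  opairing U a d es v x = opairing U' a' d es' v' x.
Proof.
move=> oU oU' UU U'x da da' hv hv' aa' ees vv'; rewrite /opairing ees vv' //.
congr (_ * _ + _).
  apply: (op_local hD oU oU' UU); rewrite ?inE //.
  - exact: vform_of_vdual.
  - exact: vform_of_vdual.
  - by move=> y s u U'y; rewrite !of_vdualE; case: s => // ; rewrite aa'.
apply: (rho_ext_local L _ oU' U'x); first exact: (dual_app_regular oU' UU da (hsec_restr oU oU' UU hv)).
by move=> y U'y; rewrite /dual_app aa' // vv'.
Qed.

(** This is linearity over functions in [a]: the term [Q g], which is minus the anchor on [g],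
    cancels the derivative of the coefficient [g] in the anchor term. *)
Lemma opairing_expand W (Fr : gframe V) a d es v x : open W -> is_gframe W Fr ->
  W x -> is_dual W a -> dual_deg W a d -> is_hsec W v ->
  opairing W a d es v x = \sum_i a x (at_pt x (@gf_sec _ _ _ Fr i)) *
    opairing W (gf_dual i) (- tag (gf_sec i)) es v x.
Proof.
move=> oW fW Wx da dega hv.
pose g i := dual_app a (@gf_sec _ _ _ Fr i).
pose b i := @gf_dual _ _ _ Fr i.
have gr i : fs_O W (g i).
  exact: (dual_app_regular oW (@subset_refl _ _) da (gf_sec_ok fW i)).
have br i : fs_O W (dual_app (b i) v).
  exact: (dual_app_regular oW (@subset_refl _ _) (gf_dual_ok fW i) hv).
have vb i : is_vform W (of_vdual E (b i)).
  by apply: vform_of_vdual => //; exact: gf_dual_ok.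
have vg i : is_vform W (fscale (of_fun E (g i)) (of_vdual E (b i))).
  by apply: vform_fscale => //; exact: form_of_fun.
have d0 i : form_deg W (of_fun E (g i)) 0.
  by move=> y [|h s] _ /=; rewrite ?eqxx // /sdeg big_nil oppr0.
have ea y (s : seq (hvec E y)) (u : hvec V y) : W y ->
    \sum_i fscale (of_fun E (g i)) (of_vdual E (b i)) y s u = of_vdual E a y s u.
  move=> Wy; under eq_bigr do rewrite fscale_fun of_vdualE.
  rewrite of_vdualE; case: s => [|? ?]; last by rewrite big1 // => i _; rewrite mulr0.
  rewrite (gframe_expand u fW Wy (dual_hlin da Wy)); apply: eq_bigr => i _.
  by rewrite mulrC.
have [vs sE] := op_sum (pts x es) (at_pt x v) oW Wx vg.
rewrite /opairing -(op_ext _ _ oW vs ea) // sE {vs sE}.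
have -> : rho_ext rho (pts x es) (dual_app a v) =
    \sum_i (rho_ext rho (pts x es) (g i) * dual_app (b i) v x +
            g i x * rho_ext rho (pts x es) (dual_app (b i) v)).
  rewrite -(rho_ext_sum L _ oW Wx gr br).
  apply: (rho_ext_local L _ oW Wx).
    exact: (dual_app_regular oW (@subset_refl _ _) da hv).
  move=> y Wy; rewrite /dual_app (gframe_expand _ fW Wy (dual_hlin da Wy)).
  by apply: eq_bigr => i _; rewrite mulrC.
rewrite mulr_sumr -big_split; apply: eq_bigr => i _ /=.
rewrite (op_leibniz hD oW (form_of_fun E oW (gr i)) (d0 i) (vb i)) //.
rewrite fscale_fun fscale_of_vdual (Q_of_fun HQ) // expr0z mul1r -/(b i) -/(g i x).
(* In the wrong degree the coefficient [g i] vanishes on all of [W], and so does its derivative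
   along the anchor. *)
have [e|ne] := eqVneq (tag (@gf_sec _ _ _ Fr i)) (- d); last first.
  have g0 y : W y -> g i y = 0 by move=> Wy; apply: dual_degN dega Wy _.
  have -> : rho_ext rho (pts x es) (g i) = 0.
    rewrite -[RHS](rho_ext0 L (pts x es)); exact: (rho_ext_local L _ oW Wx).
  rewrite -[a x (at_pt x _)]/(g i x) g0 //; ring.
rewrite e opprK.
(* A nonzero term has a word of degree [-1] and [v] of degree [-d], so the [ksign] is [(-1) ^ d] and
   cancels the sign in front. *)
suff h : (-1) ^ d * (ks (wdeg (pts x es)) (tag (at_pt x v)) *
    rho_ext rho (pts x es) (g i) * b i x (at_pt x v)) =
    rho_ext rho (pts x es) (g i) * dual_app (b i) v x.
  by rewrite -[a x (at_pt x _)]/(g i x) -h; ring.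
have [->|/rho_ext_deg ->] := eqVneq (rho_ext rho (pts x es) (g i)) 0; first by ring.
rewrite /dual_app; have [->|nz] := eqVneq (b i x (at_pt x v)) 0; first by ring.
have := gf_deg fW Wx nz; rewrite opprK e => ->.
rewrite ksNl ksNr (ksC _ 1) ks1 !mulrA.
by rewrite signz_sq mul1r.
Qed.

(** The dual sections of a [gframe] may be dependent, so it is not automatic that the vector
    assembled here has the prescribed pairings; [op_nabla_pair] obtains this from
    [opairing_expand]. *)
Definition op_nabla : taylor E V := fun U es v n x =>
  \sum_i opairing (U `&` fr_dom V x) (@gf_dual _ _ _ (fr V x) i)
    (- tag (gf_sec i)) es v x *: tot (gf_sec i) n x.
Arguments op_nabla U es v n x : clear implicits.

Lemma gframeI U x : open U -> is_gframe (U `&` fr_dom V x) (fr V x).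
Proof.
move=> oU; apply: is_gframe_restr (fr_ok V x) => //; first exact: fr_open.
  exact: open_frI.
Qed.

Lemma op_nabla_pair U a d es v x : open U -> is_dual U a -> dual_deg U a d ->
  is_hsec U v -> U x ->
  dual_tot a d (op_nabla U es v) x = opairing U a d es v x.
Proof.
move=> oU da dega hv Ux; pose W := U `&` fr_dom V x.
have oW : open W by exact: open_frI.
have WU : W `<=` U by move=> y [].
have Wx : W x by split=> //; exact: fr_mem.
have fW := gframeI x oU; have daW := dual_restr WU da.
have hvW : is_hsec W v by exact: hsec_restr hv.
rewrite (opairing_local (es' := es) _ oU oW WU Wx da daW hv hvW) //.
rewrite (opairing_expand es oW fW Wx daW (dual_deg_restr WU dega) hvW).
rewrite /dual_tot /op_nabla (hlin_sum _ _ (dual_hlin da Ux)).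
apply: eq_bigr => i _; rewrite mulrC; congr (_ * _).
have [e|ne] := eqVneq (tag (@gf_sec _ _ _ (fr V x) i)) (- d).
  by rewrite at_pt_tot.
by rewrite tot_out // (hlin0 _ (dual_hlin da Ux)) (dual_degN dega).
Qed.

Lemma op_nabla_pairN U a n es v x : open U -> is_dual U a -> dual_deg U a (- n) ->
  is_hsec U v -> U x ->
  a x (Hvec (op_nabla U es v n x)) = opairing U a (- n) es v x.
Proof.
move=> oU da dega hv Ux; rewrite -(op_nabla_pair es oU da dega hv Ux) /dual_tot.
exact: (congr1 (fun m => a x (Hvec (op_nabla U es v m x))) (esym (opprK n))).
Qed.

Lemma op_nabla_local U U' es es' v v' n x : open U -> open U' -> U' `<=` U ->
  is_hsec U v -> is_hsec U' v' -> U' x -> pts x es = pts x es' ->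
  (forall y, U' y -> at_pt y v = at_pt y v') ->
  op_nabla U es v n x = op_nabla U' es' v' n x.
Proof.
move=> oU oU' UU hv hv' U'x ees vv'; apply: eq_bigr => i _; congr (_ *: _).
have oW : open (U `&` fr_dom V x) by exact: open_frI.
have oW' : open (U' `&` fr_dom V x) by exact: open_frI.
apply: opairing_local => //.
- by move=> y [/UU].
- by split=> //; exact: fr_mem.
- exact: (gf_dual_ok (gframeI x oU)).
- exact: (gf_dual_ok (gframeI x oU')).
- exact: hsec_restr hv.
- exact: hsec_restr hv'.
- by move=> y [U'y _]; exact: vv'.
Qed.

Lemma opairing_regular U a d es v : open U -> is_dual U a -> all_hsec U es ->
  is_hsec U v -> fs_O U (opairing U a d es v).
Proof.
move=> oU da hes hv; apply: fs_linear => //.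
  apply: (vform_reg char0 oU (@subset_refl _ _) _ hes hv).
  by apply: (op_section hD oU); exact: vform_of_vdual.
by apply: rho_ext_regular => //; exact: (dual_app_regular oU (@subset_refl _ _) da hv).
Qed.

Lemma opairing_word U a d v x : open U -> is_dual U a -> is_hsec U v -> U x ->
  psym (fun es : seq (hvec E x) => (-1) ^ d * D U (of_vdual E a) x es (at_pt x v) +
    rho_ext rho es (dual_app a v)) /\
  pmlin (fun es : seq (hvec E x) => (-1) ^ d * D U (of_vdual E a) x es (at_pt x v) +
    rho_ext rho es (dual_app a v)).
Proof.
move=> oU da hv Ux.
have va := op_section hD oU (vform_of_vdual E char0 oU da).
have [sw lw] := vform_word char0 (at_pt x v) oU va Ux.
have lr := rho_ext_pmlin L oU Ux (dual_app_regular oU (@subset_refl _ _) da hv).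
split=> [p b c q|p n c u u' q].
  rewrite sw !rho_ext_size ?size_cat //=; first by ring.
    by lia.
  by lia.
by rewrite lw lr; ring.
Qed.

Lemma opairing_leibniz U a d es m (s : forall y, V m y) f x : open U -> is_dual U a ->
  bsec U s -> U x -> fs_O U f ->
  opairing U a d es (Hsec (fun y => f y *: s y)) x =
  f x * opairing U a d es (Hsec s) x +
  rho_ext rho (pts x es) f * a x (at_pt x (Hsec s)).
Proof.
move=> oU da hs Ux fU.
have va := op_section hD oU (vform_of_vdual E char0 oU da).
have lZ (g : hvec V x -> K) c (u : V m x) : hlin g -> g (Hvec (c *: u)) = c * g (Hvec u).
  by move=> lg; rewrite -[c *: u]addr0 lg (hlin0 _ lg) addr0.
have ra : fs_O U (dual_app a (Hsec s)) by exact: (dual_app_regular (e := Hsec s) oU (@subset_refl _ _) da hs).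
rewrite /opairing /at_pt /= (lZ _ _ _ (vform_hlin char0 _ va Ux)).
have -> : rho_ext rho (pts x es) (dual_app a (Hsec (fun y => f y *: s y))) =
    rho_ext rho (pts x es) (fun y => f y * dual_app a (Hsec s) y).
  have hfs := bsecZ oU fU hs.
  apply: (rho_ext_local L _ oU Ux) => [|y Uy].
    exact: (dual_app_regular (e := Hsec (fun y => f y *: s y)) oU (@subset_refl _ _) da hfs).
  have la := dual_hlin da Uy.
  by rewrite /dual_app /at_pt /= -[f y *: s y]addr0 la (hlin0 _ la) addr0.
rewrite (rho_extM L _ oU Ux fU ra) /dual_app /at_pt /=; ring.
Qed.

(** Stated for words of every length: the anchor term vanishes unless there is one letter, so this
    yields both the linearity and the Leibniz rule of a connection. *)
Lemma op_nabla_leibniz U es m (s : forall y, V m y) f n x : open U -> fs_O U f ->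
  bsec U s -> U x ->
  op_nabla U es (Hsec (fun y => f y *: s y)) n x =
  f x *: op_nabla U es (Hsec s) n x +
  rho_ext rho (pts x es) f *: tot (Hsec s) n x.
Proof.
move=> oU fU hs Ux; pose W := U `&` fr_dom V x.
have oW : open W by exact: open_frI.
have WU : W `<=` U by move=> y [].
have Wx : W x by split=> //; exact: fr_mem.
have fW : is_gframe W (fr V x) := gframeI x oU.
have hsW : bsec W s by exact: bsec_restr hs.
have fOW : fs_O W f by exact: fs_restr fU.
rewrite {1}/op_nabla -/W; under eq_bigr => i _.
  rewrite (opairing_leibniz _ _ oW (gf_dual_ok fW i) hsW Wx fOW) scalerDl -!scalerA; over.
rewrite big_split /= -!scaler_sumr; congr (_ + _ *: _).
have [e|ne] := eqVneq m n.
  subst n; rewrite [RHS](gf_resol fW _ Wx) tot_Hsec.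
  by apply: eq_bigr => i _.
rewrite tot_out // big1 // => i _.
have [e|ne'] := eqVneq (tag (@gf_sec _ _ _ (fr V x) i)) n; last by rewrite tot_out // scaler0.
rewrite (dual_degN (gf_deg fW (i := i)) Wx) ?scale0r //= opprK e //.
Qed.

(** The frame used by [op_nabla] changes with the point. Regularity is therefore tested against the
    coordinate functionals [cdual i] of a fixed bundle frame, whose pairings are given by
    [opairing]. *)
Lemma op_nabla_section U es v n : open U -> all_hsec U es -> is_hsec U v ->
  bsec U (op_nabla U es v n).
Proof.
move=> oU hes hv A FA; have [oA _] := vb_frame FA.
pose W := U `&` lf_dom A; have oW : open W by exact: openI.
have WU : W `<=` U by move=> y [].
have hesW := all_hsec_restr oU oW WU hes; have hvW := hsec_restr oU oW WU hv.
exists (fun i x => lcoord i (op_nabla U es v n x)).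
split=> [i|x Ux Ax]; last exact: lcoordE.
have dc : is_dual W (cdual i) by apply: cdual_dual => // y [].
apply: fs_ext (opairing_regular (- n) oW dc hesW hvW) => // x Wx.
have gc : dual_deg W (cdual i) (- n) by exact: cdual_deg.
rewrite -(op_nabla_pairN es oW dc gc hvW Wx).
rewrite -(op_nabla_local (es := es) n oU oW WU hv hvW Wx (erefl _)) //.
by rewrite /cdual untag_Hvec.
Qed.

Lemma op_nabla_deg U es v n x : open U -> is_hsec U v -> U x ->
  n != sdeg (degs es) + tag v + 1 -> op_nabla U es v n x = 0.
Proof.
move=> oU hv Ux ne; rewrite /op_nabla big1 // => i _; set W := U `&` _.
have oW : open W by exact: open_frI.
have WU : W `<=` U by move=> y [].
have Wx : W x by split=> //; exact: fr_mem.
have fW : is_gframe W (fr V x) := gframeI x oU.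
have [e|nn] := eqVneq (tag (@gf_sec _ _ _ (fr V x) i)) n; last by rewrite tot_out // scaler0.
rewrite -(wdeg_pts x) in ne.
have db := gf_dual_ok fW i; have degb := gf_deg fW (i := i); rewrite e in degb.
have vb := vform_of_vdual E char0 oW db.
rewrite /opairing.
have [->|nz] := eqVneq (D W (of_vdual E (gf_dual i)) x (pts x es) (at_pt x v)) 0.
  rewrite mulr0 add0r.
  have [->|/rho_ext_deg w1] := eqVneq (rho_ext rho (pts x es) (dual_app (gf_dual i) v)) 0.
    by rewrite scale0r.
  (* A nonzero anchor term has a word of degree [-1], for which the excluded degree is that of [v];
     hence the pairing with [v] is zero near [x], a contradiction. *)
  have nv : tag v != n by apply: contraNneq ne => ->; apply/eqP; rewrite w1; ring.
  have -> : rho_ext rho (pts x es) (dual_app (gf_dual i) v) = 0.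
    have hvW : is_hsec W v by exact: hsec_restr hv.
    rewrite -[RHS](rho_ext0 L (pts x es)); apply: (rho_ext_local L _ oW Wx).
      exact: (dual_app_regular oW (@subset_refl _ _) db hvW).
    by move=> y Wy; apply: (dual_degN degb Wy); rewrite opprK.
  by rewrite scale0r.
have := op_degree hD oW vb (of_vdual_deg degb) Wx nz.
rewrite -/(wdeg (pts x es)) => h; case/eqP: ne.
have -> : wdeg (pts x es) + tag v = - (- n + 1) by rewrite -h.
by ring.
Qed.

Lemma op_nabla_connection : is_connection L op_nabla.
Proof.
have frameW U x i : open U -> is_dual (U `&` fr_dom V x) (@gf_dual _ _ _ (fr V x) i).
  by move=> oU; exact: (gf_dual_ok (gframeI x oU) i).
have hvW U x v : open U -> is_hsec U v -> is_hsec (U `&` fr_dom V x) v.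
  by move=> oU hv; apply: hsec_restr hv => //; exact: open_frI.
have Wx U x : U x -> (U `&` fr_dom V x) x by split=> //; exact: fr_mem.
split.
- exact: op_nabla_section.
- move=> U U' es es' v v' oU oU' UU hes hes' hv hv' h n x U'x.
  by apply: op_nabla_local => //; [exact: (h x U'x).1 | move=> y /h[]].
- by move=> U es v n x oU hes hv Ux; exact: op_nabla_deg.
- move=> U p a b q v n x oU hes hv Ux; rewrite /op_nabla scaler_sumr.
  apply: eq_bigr => i _; rewrite scalerA; congr (_ *: _).
  have [s _] := opairing_word (- tag (gf_sec i)) (open_frI V x oU) (frameW U x i oU) (hvW U x v oU hv) (Wx U x Ux).
  by rewrite /opairing !pts_cat /=; exact: s.
- move=> U p d s t q v n x oU hs ht hv Ux; rewrite /op_nabla -big_split /=.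
  apply: eq_bigr => i _; rewrite -scalerDl; congr (_ *: _).
  have [_ l] := opairing_word (- tag (gf_sec i)) (open_frI V x oU) (frameW U x i oU) (hvW U x v oU hv) (Wx U x Ux).
  have := l (pts x p) d 1 (s x) (t x) (pts x q).
  by rewrite scale1r mul1r /opairing !pts_cat.
- move=> U p d s q v f n x oU fU hs hv Ux; rewrite /op_nabla scaler_sumr.
  apply: eq_bigr => i _; rewrite scalerA; congr (_ *: _).
  have [_ l] := opairing_word (- tag (gf_sec i)) (open_frI V x oU) (frameW U x i oU) (hvW U x v oU hv) (Wx U x Ux).
  have := l (pts x p) d (f x) (s x) 0 (pts x q).
  by rewrite addr0 (pmlin0 _ _ _ l) addr0 /opairing !pts_cat.
- move=> U es d s t n x oU hes hs ht Ux; rewrite /op_nabla -big_split /=.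
  apply: eq_bigr => i _; rewrite -scalerDl; congr (_ *: _).
  have oW := open_frI V x oU; have db := frameW U x i oU.
  have hsW := hvW U x (Hsec s) oU hs; have htW := hvW U x (Hsec t) oU ht.
  have vb := op_section hD oW (vform_of_vdual E char0 oW db).
  rewrite /opairing.
  have -> : D (U `&` fr_dom V x) (of_vdual E (gf_dual i)) x (pts x es)
      (at_pt x (Hsec (fun y => s y + t y))) =
      D (U `&` fr_dom V x) (of_vdual E (gf_dual i)) x (pts x es) (at_pt x (Hsec s)) +
      D (U `&` fr_dom V x) (of_vdual E (gf_dual i)) x (pts x es) (at_pt x (Hsec t)).
    by have := vform_hlin char0 (pts x es) vb (Wx U x Ux) 1 (s x) (t x); rewrite scale1r mul1r.
  have rs := dual_app_regular oW (@subset_refl _ _) db hsW.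
  have rt := dual_app_regular oW (@subset_refl _ _) db htW.
  have -> : rho_ext rho (pts x es) (dual_app (gf_dual i) (Hsec (fun y => s y + t y))) =
      rho_ext rho (pts x es) (dual_app (gf_dual i) (Hsec s)) +
      rho_ext rho (pts x es) (dual_app (gf_dual i) (Hsec t)).
    rewrite -[X in X + _]mul1r -(rho_ext_lin L _ 1 oW (Wx U x Ux) rs rt).
    apply/esym/(rho_ext_local L _ oW (Wx U x Ux)); first exact: fs_linear.
    move=> y Wy; rewrite /dual_app /at_pt /=.
    by rewrite -(dual_hlin db Wy) scale1r.
  by ring.
- move=> U es d s f n x oU sz fU hes hs Ux.
  by rewrite op_nabla_leibniz // rho_ext_size ?size_map // scale0r addr0.
- by move=> U e d s f n x oU fU he hs Ux; rewrite op_nabla_leibniz.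
Qed.

Lemma op_nabla_corresponds : corresponds L op_nabla D.
Proof.
move=> U a d es v x oU da dega hes hv Ux.
rewrite (op_nabla_pair es oU da dega hv Ux) /opairing signzD expr1z.
by rewrite mulrDr mulrA signz_sq; ring.
Qed.

(** A vector of V is recovered from its pairings with the dual sections of a frame, and the
    correspondence prescribes these. *)
Lemma op_nabla_unique nabla : is_connection L nabla -> corresponds L nabla D ->
  eq_taylor nabla op_nabla.
Proof.
move=> cn cr U es v oU hes hv n x Ux; pose W := U `&` fr_dom V x.
have oW : open W by exact: open_frI.
have WU : W `<=` U by move=> y [].
have Wx : W x by split=> //; exact: fr_mem.
have fW : is_gframe W (fr V x) := gframeI x oU.
have hesW := all_hsec_restr oU oW WU hes; have hvW := hsec_restr oU oW WU hv.
rewrite (cn_local cn oU oW WU hes hesW hv hvW) //.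
rewrite (op_nabla_local (es' := es) (v' := v) n oU oW WU hv hvW Wx) //.
rewrite [LHS](gf_resol fW _ Wx) [RHS](gf_resol fW _ Wx).
apply: eq_bigr => i _.
have [e|ne] := eqVneq (tag (@gf_sec _ _ _ (fr V x) i)) n; last by rewrite tot_out // !scaler0.
congr (_ *: _); have db := gf_dual_ok fW i.
have degb := gf_deg fW (i := i); rewrite e in degb.
rewrite (op_nabla_pairN es oW db degb hvW Wx) /opairing.
rewrite (cr _ _ _ _ _ _ oW db degb hesW hvW Wx) signzD expr1z.
rewrite mulrDr mulrA signz_sq /dual_tot.
rewrite (congr1 (fun m => gf_dual i (Hvec (nabla W es v m x))) (opprK n)).
rewrite mul1r -addrA mulrA mulrA signz_sq; ring.
Qed.

End OneOperator.

Lemma op_unique (D D' : operator E V) :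
  is_leibniz_operator Q D -> is_leibniz_operator Q D' ->
  (forall U a d x es h, open U -> is_dual U a -> dual_deg U a d -> U x ->
     D U (of_vdual E a) x es h = D' U (of_vdual E a) x es h) ->
  eq_operator D D'.
Proof.
move=> hD hD' DD' U w oU vw x es h Ux; pose W := fr_dom V x `&` U.
have oW : open W by apply: openI => //; exact: fr_open.
have WU : W `<=` U by move=> y [].
have Wx : W x by split=> //; exact: fr_mem.
have fW : is_gframe W (fr V x).
  by apply: is_gframe_restr (fr_ok V x) => //; [exact: fr_open | move=> y []].
pose xi i := twf (tag (@gf_sec _ _ _ (fr V x) i)) (vat (gf_sec i) w).
have fxi i : is_form W (xi i).
  by apply: form_tw => //; apply: (vform_form char0 (U := U)) => //; exact: (gf_sec_ok fW i).
(* The coefficient forms [xi i] are split into homogeneous parts on a common neighbourhood, so that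
   [op_leibniz] applies to each part. *)
have [Z [oZ Zx hZ]] : exists Z, [/\ open Z, Z x & forall i, Z `<=` W /\
    exists N : nat, forall y s, Z y -> xi i y s = \sum_(d < N) cutdeg (Posz d) (xi i) y s].
  apply: finite_shrink => [i Z Z' _ ZZ' [ZW [N hN]]|i].
    split; first by move=> y /ZZ'/ZW.
    by exists N => y s /ZZ'; exact: hN.
  have [Z [N [oZ Zx ZW hN]]] := form_homogeneous (li_negative (li_laws L)) oW (fxi i) Wx.
  by exists Z; split=> //; split=> //; exists N.
pose Y := Z `&` W; have oY : open Y by exact: openI.
have YW : Y `<=` W by move=> y [].
have YU : Y `<=` U by move=> y /YW/WU.
have Yx : Y x by [].
have vwY := vform_restr char0 oY YU vw.
rewrite (op_local hD oU oY YU vw vwY) // (op_local hD' oU oY YU vw vwY) //.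
pose N i := sval (cid (hZ i).2).
have hN i y s : Y y -> xi i y s = \sum_(d < N i) cutdeg (Posz d) (xi i) y s.
  by move=> [Zy _]; rewrite /N; case: cid => M /= hM; exact: hM.
pose b i := @gf_dual _ _ _ (fr V x) i.
have vb i : is_vform Y (of_vdual E (b i)).
  apply: vform_of_vdual => //; exact: dual_restr (gf_dual_ok fW i).
have fc i d : is_form Y (cutdeg d (xi i)).
  by apply: form_cutdeg => //; exact: form_restr (fxi i).
have vc i (d : 'I_(N i)) : is_vform Y (fscale (cutdeg (Posz d) (xi i)) (of_vdual E (b i))).
  exact: vform_fscale.
have vs i : is_vform Y (fun y s u => \sum_(d < N i)
    fscale (cutdeg (Posz d) (xi i)) (of_vdual E (b i)) y s u).
  exact: (op_sum hD es h oY Yx (vc i)).1.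
have we y (s : seq (hvec E y)) (u : hvec V y) : Y y -> \sum_i \sum_(d < N i)
    fscale (cutdeg (Posz d) (xi i)) (of_vdual E (b i)) y s u = w y s u.
  move=> Yy; have Wy := YW y Yy.
  rewrite [RHS](gframe_expand u fW Wy (vform_hlin char0 s vw (WU y Wy))).
  apply: eq_bigr => i _; under eq_bigr do rewrite fscale_of_vdual.
  rewrite -mulr_suml -mulr_sumr -hN // /xi /twf /tw mulrA -/(b i).
  have [->|/(gf_deg fW Wy)] := eqVneq (b i y u) 0; first by rewrite mulr0 mul0r.
  by rewrite opprK => ->; rewrite ks_sq mul1r mulrC.
have [vS eD] := op_sum hD es h oY Yx vs.
have [_ eD'] := op_sum hD' es h oY Yx vs.
rewrite -(op_ext hD _ _ oY vS we) // -(op_ext hD' _ _ oY vS we) // eD eD'.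
apply: eq_bigr => i _.
rewrite (op_sum hD es h oY Yx (vc i)).2 (op_sum hD' es h oY Yx (vc i)).2.
apply: eq_bigr => d _; have dc := cutdeg_deg (U := Y) (d := Posz d) (F := xi i).
rewrite (op_leibniz hD oY (fc i _) dc (vb i)) // (op_leibniz hD' oY (fc i _) dc (vb i)) //.
congr (_ + _ * _); rewrite !fscaleE; apply: eq_pmul => // s.
apply: (DD' _ _ (- tag (gf_sec i))) => //.
  exact: dual_restr (gf_dual_ok fW i).
exact: dual_deg_restr YW (gf_deg fW (i := i)).
Qed.

(** The correspondence speaks of sections only; every word of vectors at [x], together with a vector
    of V, is the value of sections over a smaller neighbourhood. *)
Lemma corresponds_agree (nabla : taylor E V) (D D' : operator E V) :
  is_leibniz_operator Q D -> is_leibniz_operator Q D' ->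
  corresponds L nabla D -> corresponds L nabla D' ->
  forall U a d x es h, open U -> is_dual U a -> dual_deg U a d -> U x ->
  D U (of_vdual E a) x es h = D' U (of_vdual E a) x es h.
Proof.
move=> hD hD' cD cD' U a d x es h oU da dega Ux.
pose W := (U `&` fr_dom E x) `&` fr_dom V x.
have oU1 : open (U `&` fr_dom E x) by exact: open_frI.
have oW : open W by exact: open_frI.
have WU : W `<=` U by move=> y [[]].
have Wx : W x by split; [split=> //|]; exact: fr_mem.
have daW := dual_restr WU da; have degW := dual_deg_restr WU dega.
have va := vform_of_vdual E char0 oU da; have vaW := vform_of_vdual E char0 oW daW.
have hes : all_hsec W [seq extend e | e <- es].
  by apply: all_hsec_restr (all_hsec_extendI es oU) => // y [].
have hh : is_hsec W (extend h) by exact: extend_hsecI.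
rewrite (op_local hD oU oW WU va vaW) // (op_local hD' oU oW WU va vaW) //.
rewrite -[es]pts_extend -[h]at_pt_extend.
by rewrite (cD _ _ _ _ _ _ oW daW degW hes hh Wx) (cD' _ _ _ _ _ _ oW daW degW hes hh Wx).
Qed.

End Operators.

Lemma base_space_char0 (K : fieldType) (X : fspace K) :
  base_space X -> [pchar K] =i pred0.
Proof.
case=> [R Y _|R Y _|//]; first exact: (@pchar_num R).
exact: (@pchar_num (complex R)).
Qed.

Theorem proposition3p17 (K : fieldType) (X : fspace K) (HX : base_space X)
    (E : gbundle X) (L : lie_infty_algebroid E)
    (Q : set X -> sform E -> sform E) (HQ : is_homological L Q)
    (V : gbundle X) :
  one_to_one (is_connection L (V:=V)) (@eq_taylor K X E V)
             (is_leibniz_operator Q (V:=V)) (@eq_operator K X E V)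
             (corresponds L (V:=V)).
Proof.
have char0 := base_space_char0 HX.
split=> [nabla cn|D hD].
  have hD := dual_op_is_operator char0 HQ cn.
  have cD := dual_op_corresponds char0 HQ cn.
  exists (dual_op Q nabla); split=> // D' hD' cD'.
  apply: (op_unique L char0 hD' hD) => U a d x es h.
  exact: (corresponds_agree char0 hD' hD cD' cD).
exists (op_nabla L D); split.
- exact: (op_nabla_connection char0 HQ hD).
- exact: (op_nabla_corresponds char0 HQ hD).
- by move=> nabla cn cr; exact: (op_nabla_unique char0 HQ hD cn cr).
Qed.
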